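(* Assume that $1$ is not in the interior of $\{x\in\mathbb R:\varphi(x)=0\}$. Let $\Sigma\subseteq\mathcal F$ be a $\sigma$-ideal and $g\in L^0(\Sigma)$. Let $X_g=\{\mu\in\mathcal M:|\mu|(A)=0\ \forall A\in\Sigma,\ \int|g|\,d|\mu|<\infty\}$, $X^1_g=X_g\cap\mathcal M^1$, $\Xi=\{A\in\mathcal F:\forall\mu\in X_g,\ |\mu|(A)=0\}$, and $\mathcal M_c^1(\Xi)=\{\mu\in\mathcal M^1:\mu(A)=0\ \forall A\in\Xi\}$. Let $\nu\in X_g^1$. Then the following are equivalent: (i) for every sequence $(\nu_n)_{n\in\mathbb N}$ in $\mathcal M^1_c(\Xi)$, $\lim_{n\to\infty}D_\varphi(\nu_n\|\nu)=0$ implies that $g$ is $\nu_n$-integrable for all sufficiently large $n$ and $\lim_{n\to\infty}\int g\,d\nu_n=\int g\,d\nu$; (ii) for every sequence $(\nu_n)_{n\in\mathbb N}$ in $X_g^1$, $\lim_{n\to\infty}D_\varphi(\nu_n\|\nu)=0$ implies $\lim_{n\to\infty}\int g\,d\nu_n=\int g\,d\nu$; (iii) the subdifferential of $K_{g,\nu,\Xi}$ at $0$ is $\{0\}$, i.e. $K_{g,\nu,\Xi}$ is differentiable at $0$ with $K_{g,\nu,\Xi}'(0)=0$; (iv) $0$ is in the interior of $\operatorname{dom}K_{g,\nu,\Xi}=\{t:K_{g,\nu,\Xi}(t)<\infty\}$; that is, $g\in L^\infty(\Xi)$ when $\varphi'(\infty)<\infty$, and $g$ is $(\varphi,\nu)$-subexponential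 when $\varphi'(\infty)=\infty$.
   Context: $(\Omega,\mathcal F)$ is a measurable space with $\{\emptyset,\Omega\}\subsetneq\mathcal F$; $\mathcal M,\mathcal M^+,\mathcal M^1$ are the sets of finite signed measures, finite non-negative measures and probability measures on it. For a $\sigma$-ideal $\Xi\subseteq\mathcal F$, $L^0(\Xi)$ is the space of real measurable functions modulo equality outside an element of $\Xi$; $\operatorname{ess\,im}_\Xi f=\bigcap_{\epsilon>0}\{x\in\mathbb R: f^{-1}((x-\epsilon,x+\epsilon))\notin\Xi\}$, $\operatorname{ess\,sup}_\Xi f=\sup\operatorname{ess\,im}_\Xi f$, and $L^\infty(\Xi)$ is the space of functions with bounded $\Xi$-essential range. Standing assumptions on $\varphi$: $\varphi:\mathbb R\to[0,+\infty]$ is convex, lower semicontinuous, $\varphi(1)=0$, $\varphi(x)=+\infty$ for $x<0$, and $\operatorname{dom}\varphi$ contains a neighborhood of $1$. $\varphi'(\pm\infty)=\lim_{x\to\pm\infty}\varphi(x)/x$. Set $\psi(x)=\varphi(x+1)$; $f^\star(y)=\sup_x\{xy-f(x)\}$ denotes the convex conjugate. For $\mu\in\mathcal M$, $\nu\in\mathcal M^+$ with Lebesgue decomposition $\mu=\mu_c+\mu_s$ ($\mu_c\ll\nu$, $\mu_s\perp\nu$) and Hahn–Jordan decomposition $\mu_s=\mu_s^+-\mu_s^-$, $D_\varphi(\mu\|\nu)=\int\varphi(\frac{d\mu_c}{d\nu})d\nu+\mu_s^+(\Omega)\varphi'(\infty)-\mu_s^-(\Omega)\varphi'(-\infty)$,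 with $0\cdot(\pm\infty)=0$. Cumulant generating function: for $\nu\in\mathcal M^1$ vanishing on $\Xi$ and $g\in L^0(\Xi)$, $$K_{g,\nu,\Xi}(t)=\inf\Big\{\int\psi^\star(tg+\lambda)\,d\nu:\lambda\in\mathbb R,\ \lambda+\operatorname{ess\,sup}_\Xi(tg)\le\varphi'(\infty)\Big\},\quad t\in\mathbb R.$$ $K_{g,\nu}$ denotes $K_{g,\nu,N}$ with $N$ the $\sigma$-ideal of $\nu$-null sets; $g$ is $(\varphi,\nu)$-subexponential if $0\in\operatorname{int}\{t:K_{g,\nu}(t)<\infty\}$. *)

(* Defs.v *)
From HB Require Import structures.
From mathcomp Require Import all_boot all_order all_algebra.
From mathcomp Require Import all_classical all_reals all_analysis.
Import Order.TTheory GRing.Theory Num.Theory.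
Import numFieldNormedType.Exports.

Set Implicit Arguments.
Unset Strict Implicit.
Unset Printing Implicit Defensive.

Local Open Scope classical_set_scope.
Local Open Scope ring_scope.
Local Open Scope ereal_scope.
Local Open Scope charge_scope.

Section convex_analysis.
Context {R : realType}.
Implicit Types f phi : R -> \bar R.

Definition edom f : set R := [set x | f x < +oo].

(* The products use the convention 0 * +oo = 0, so the end points 0 and 1 are
   harmless. *)
Definition econvex f := forall (x y t : R), (0 <= t <= 1)%R ->
  f (t * x + (1 - t) * y)%R <= t%:E * f x + (1 - t)%:E * f y.

Record divergence_generator phi : Prop := DivergenceGenerator {
  dg_ge0 : forall x, 0 <= phi x ;
  dg_convex : econvex phi ;
  dg_lsc : lower_semicontinuous phi ;
  dg_1 : phi 1%R = 0 ;
  dg_neg : forall x : R, (x < 0)%R -> phi x = +oo ;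
  dg_nbhs1 : nbhs (1 : R)%R (edom phi) }.

(* phi'(+oo) and phi'(-oo): the limits exist in \bar R by convexity. *)
Definition slope_pinfty phi : \bar R := lim (phi x * (x^-1)%:E @[x --> +oo%R]).

Definition slope_ninfty phi : \bar R := lim (phi x * (x^-1)%:E @[x --> -oo%R]).

Definition conjugate f (y : R) : \bar R :=
  ereal_sup (range (fun x : R => (x * y)%:E - f x)).

Definition subdifferential f (x : R) : set R :=
  [set s | f x \is a fin_num /\ forall y, f x + (s * (y - x))%:E <= f y].

Definition differentiable_with f (x a : R) :=
  (\forall y \near x, f y \is a fin_num) /\
  is_derive x (1%R : R) (fine \o f) a.

End convex_analysis.

Section signed_measures.
Context d (T : measurableType d) (R : realType).
Implicit Type mu : {charge set T -> \bar R}.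

Definition hahn_sets mu :
    {PN : set T * set T | hahn_decomposition mu PN.1 PN.2} :=
  let: exist P exN := cid (Hahn_decomposition mu) in
  let: exist N hPN := cid exN in
  exist (fun PN => hahn_decomposition mu PN.1 PN.2) (P, N) hPN.

Definition pos_part mu := jordan_pos (svalP (hahn_sets mu)).

Definition neg_part mu := jordan_neg (svalP (hahn_sets mu)).

Definition variation mu := charge_variation (svalP (hahn_sets mu)).

Variable nu : {finite_measure set T -> \bar R}.

Definition singular mu :=
  exists N, [/\ measurable N, nu N = 0 & variation mu (~` N) = 0].

Definition lebesgue_decomposition (mu mu_c mu_s : {charge set T -> \bar R}) :=
  [/\ forall A, measurable A -> mu A = mu_c A + mu_s A,
      mu_c `<< nu & singular mu_s].

Lemma lebesgue_decomposition_exists mu :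
  exists p : {charge set T -> \bar R} * {charge set T -> \bar R},
    lebesgue_decomposition mu p.1 p.2.
Proof.
pose m : {measure set T -> \bar R} := variation mu.
pose S := [set m A | A in [set A | measurable A /\ nu A = 0]].
have S0 : S != set0 by apply/set0P; exists (m set0), set0.
have [u /= Su uS] := ereal_sup_seq S0.
have /choice[F HF] : forall n, exists A, [/\ measurable A, nu A = 0 & m A = u n].
  by move=> n; have [A [mA A0] <-] := Su n; exists A.
have mF n : measurable (F n) by have [] := HF n.
pose N := \bigcup_n F n.
have mN : measurable N by exact: bigcupT_measurable.
have mNC : measurable (~` N) by exact: measurableC.
have nuN : nu N = 0.
  apply: measure_negligible => //; apply: negligible_bigcup => k.
  by apply/negligibleP => //; have [] := HF k.
have supN : ereal_sup S <= m N.
  rewrite -(cvg_lim _ uS)//; apply: lime_le; first by apply/cvgP: uS.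
  apply: nearW => n; have [_ _ <-] := HF n.
  by rewrite le_measure ?inE//; exact: bigcup_sup.
have nullC A : measurable A -> nu A = 0 -> m (A `&` ~` N) = 0.
  move=> mA A0.
  have mAN : measurable (A `&` ~` N) by exact: measurableI.
  have AN0 : nu (A `&` ~` N) = 0.
    by apply/eqP; rewrite eq_le measure_ge0 andbT -A0 le_measure ?inE.
  have NAN : S (m N + m (A `&` ~` N)).
    exists (N `|` (A `&` ~` N)); last by rewrite measureU// setICA setICr setI0.
    split; first exact: measurableU.
    apply: measure_negligible; first exact: measurableU.
    by apply: negligibleU; exact/negligibleP.
  have mNfin : m N \is a fin_num by rewrite /m/= fin_num_measure.
  have := le_trans (ereal_sup_ubound NAN) supN.
  rewrite -[leRHS]adde0 leeD2lE// => m0.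
  by apply/eqP; rewrite eq_le m0 measure_ge0.
exists (crestr0 mu mNC : {charge set T -> \bar R},
        crestr0 mu mN : {charge set T -> \bar R}); split => /=.
- move=> A mA; rewrite /crestr0 mem_set// /crestr -chargeU.
  + by rewrite -setIUr setUC setUCr setIT.
  + exact: measurableI.
  + exact: measurableI.
  + by rewrite setIACA setICl setI0.
- apply/null_content_dominatesP => A mA A0; rewrite /crestr0 mem_set// /crestr.
  apply/eqP; rewrite -abse_eq0 eq_le abse_ge0 andbT -(nullC A mA A0).
  by apply: abse_charge_variation; exact: measurableI.
- exists N; split => //; rewrite /variation /charge_variation /=.
  case: (hahn_sets _) => -[P M] /= h.
  have [[mP _] [mM _] _ _] := h.
  have Z B (mB : measurable B) : crestr0 (crestr0 mu mN) mB (~` N) = 0.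
    rewrite {1}/crestr0 mem_set// /crestr /crestr0 mem_set; last exact: measurableI.
    by rewrite /crestr setIAC setICl set0I charge0.
  by rewrite jordan_posE cjordan_posE jordan_negE cjordan_negE !Z oppe0 adde0.
Qed.

(* The decomposition is unique on measurable sets, so the choice is immaterial
   below. *)
Definition ac_part mu := (sval (cid (lebesgue_decomposition_exists mu))).1.

Definition sing_part mu := (sval (cid (lebesgue_decomposition_exists mu))).2.

End signed_measures.

(* The density 'd mu_c '/d nu is everywhere finite, so [fine] loses nothing; the
   products use 0 * +oo = 0 * -oo = 0. *)
Definition phi_divergence d (T : measurableType d) (R : realType)
    (phi : R -> \bar R) (mu : {charge set T -> \bar R})
    (nu : {finite_measure set T -> \bar R}) : \bar R :=
  \int[nu]_x phi (fine ('d (ac_part nu mu) '/d nu x))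
  + pos_part (sing_part nu mu) setT * slope_pinfty phi
  - neg_part (sing_part nu mu) setT * slope_ninfty phi.

(* Elements of L^0(Xi) are handled through measurable representatives
   T -> R; the notions below do not change when g is modified on a set of Xi
   (for [ess_im], [in_Linfty]), of Sigma (for [Xspace]), or, in [cumulant], of an
   ideal Xi of nu-null sets. *)
Section sigma_ideals.
Context d (T : measurableType d) (R : realType).
Implicit Types (Sigma Xi : set (set T)) (f g : T -> R).

Record sigma_ideal Sigma : Prop := SigmaIdeal {
  sigma_ideal_measurable : Sigma `<=` measurable ;
  sigma_ideal0 : Sigma set0 ;
  sigma_idealS : forall A B, Sigma A -> measurable B -> B `<=` A -> Sigma B ;
  sigma_ideal_bigcup : forall F : nat -> set T,
    (forall n, Sigma (F n)) -> Sigma (\bigcup_n F n) }.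

Definition null_ideal (nu : set T -> \bar R) : set (set T) :=
  [set A | measurable A /\ nu A = 0].

Definition ess_im Xi f : set R :=
  \bigcap_(e in [set e : R | (0 < e)%R])
    [set x | ~ Xi (f @^-1` `](x - e)%R, (x + e)%R[)].

Definition ideal_ess_sup Xi f : \bar R := ereal_sup (EFin @` ess_im Xi f).

Definition in_Linfty Xi f :=
  measurable_fun [set: T] f /\ bounded_set (ess_im Xi f).

Definition Xspace Sigma g : set (charge T R) :=
  [set mu | (forall A, Sigma A -> variation mu A = 0) /\
            \int[variation mu]_x `|g x|%:E < +oo].

Definition Xspace1 Sigma g : set (probability T R) :=
  [set P | Xspace Sigma g (charge_of_finite_measure P)].

Definition null_of_Xspace Sigma g : set (set T) :=
  [set A | measurable A /\
    forall mu : {charge set T -> \bar R}, Xspace Sigma g mu -> variation mu A = 0].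

Definition Mc1 Xi : set (probability T R) :=
  [set P | forall A, Xi A -> P A = 0].

End sigma_ideals.

Section cumulant.
Context d (T : measurableType d) (R : realType).
Variable phi : R -> \bar R.

Definition shift1 (x : R) : \bar R := phi (x + 1)%R.

Definition cumulant (g : T -> R) (nu : probability T R) (Xi : set (set T))
    (t : R) : \bar R :=
  ereal_inf [set \int[nu]_x conjugate shift1 (t * g x + l)%R | l in
    [set l : R | l%:E + ideal_ess_sup Xi (fun x => (t * g x)%R)
                   <= slope_pinfty phi]].

Definition subexponential (g : T -> R) (nu : probability T R) :=
  (edom (cumulant g nu (null_ideal nu)))° (0 : R)%R.

End cumulant.

(* Main.v *)
Require Import Defs.

(* Write psi x = phi (x + 1) and K for the cumulant generating function, which is
   nonnegative, vanishes at 0 and satisfies K (s t) <= s K t for 0 <= s <= 1.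
   Everything is reduced to two one-sided conditions on g and on - g:
   K t < +oo for some t > 0, and K t <= e t for every e > 0 and some t > 0.

   Finiteness implies smallness because 1 is not interior to {phi = 0}: then
   psi^* (y) = o(y) on one side of 0.  If this holds on the right (resp. left),
   one bounds K (s) by the integral of psi^* (s (g + L)) with L very large (resp.
   very negative), and dominated convergence as s -> 0 leaves a remainder that
   vanishes in the limit of L.

   Smallness implies continuity by the Fenchel-Young inequality
   t (int g dmu - int g dnu) <= D (mu || nu) + K t.

   Conversely, if K is infinite on the right, then nu can be perturbed into
   mixtures (1 - e) nu + e P that shift the mean of g by exactly 1 at vanishing
   cost.  When phi'(oo) < +oo, P is carried by {g > n}, and the cost is at most
   phi (1 - e) + e phi'(oo).  When phi'(oo) = +oo, P has a density proportional to
   X (t g) on {M <= g <= k}, where X y is the largest x with psi x <= x y: since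
   psi^* (y) <= X y * y, divergence of the integral of psi^* (t g) makes the mean
   of g under X (t g) as large as desired, at a cost at most t times that mean. *)

From HB Require Import structures.
From mathcomp Require Import all_boot all_order all_algebra.
From mathcomp Require Import all_classical all_reals all_analysis.
From mathcomp Require Import measurable_realfun ring lra.
Import Order.TTheory GRing.Theory Num.Theory.
Import numFieldNormedType.Exports.

Set Implicit Arguments.
Unset Strict Implicit.
Unset Printing Implicit Defensive.

Local Open Scope classical_set_scope.
Local Open Scope ring_scope.
Local Open Scope ereal_scope.

(** * Convex conjugates *)

Section conjugate_theory.
Context {R : realType}.
Implicit Types f : R -> \bar R.

(** The obstacle is the infimum over [l] in the cumulant: finiteness at one [t0] yields a single
    admissible [l0], which need not suit smaller [t]. With [l = t * L] and [L] fixed, [t * g + l]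
    becomes [t * (g + L)], and everything scales with [t], the constraint included because phi'(oo)
    is nonnegative. The choice of [L] follows from the side of 0 on which psi^* is not known to be
    o(y): [L] pushes [g + L] away from that side, so that its contribution is small. Condition (ii)
    only tests measures of X_g^1, so a perturbing [P] has to integrate [g] and vanish on [Sigma].
    This is why [P] is a normalized restriction of some |mu| with mu in X_g, or has a bounded
    density supported where [g] is bounded. The weight [e] is the inverse of the gap between the
    means of [g] under [P] and [nu], hence small when the gap is large. Integrability of [g] is part
    of the conclusion of (i), so the inequalities are integrated in [0, +oo] with positive and
    negative parts on opposite sides. *)

Lemma conjugate_ub f x y : (x * y)%:E - f x <= conjugate f y.
Proof. by apply: ereal_sup_ubound; exists x. Qed.

Lemma conjugate_le f y (a : \bar R) :
  (forall x, (x * y)%:E - f x <= a) -> conjugate f y <= a.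
Proof. by move=> h; apply: ge_ereal_sup => _ [x _ <-]. Qed.

(** A supremum of affine functions: the [x] that witnesses [a < conjugate f y] still works on an
    open set around [y]. Measurability of the conjugate follows from this. *)
Lemma conjugate_lsc f : lower_semicontinuous (conjugate f).
Proof.
move=> y a /ereal_sup_gt[_ [x _ <-] ayx].
have [fxy|fxfin|fxNy] : [\/ f x = +oo, f x \is a fin_num | f x = -oo].
  by case: (f x) => [r| |]; [constructor 2|constructor 1|constructor 3].
- by move: ayx; rewrite fxy.
- exists [set z | (a + fine (f x) < x * z)%R]; last first.
    move=> z /= az; apply: lt_le_trans (conjugate_ub f x z).
    by rewrite -(fineK fxfin) -EFinB lte_fin ltrBrDr.
  apply: (@open_nbhs_nbhs _ y); split; last first.
    by rewrite /= -ltrBrDr -lte_fin EFinB fineK.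
  have -> : [set z | (a + fine (f x) < x * z)%R] =
            (fun z => x * z)%R @^-1` [set u | (a + fine (f x) < u)%R] by [].
  apply: open_comp; last exact: open_gt.
  by move=> z _; apply: continuousM; [exact: cst_continuous|exact: id].
- exists setT; first exact: filterT.
  move=> z _; apply: lt_le_trans (conjugate_ub f x z).
  by rewrite fxNy/= addey// ltry.
Qed.

Lemma measurable_conjugate f : measurable_fun setT (conjugate f : R -> \bar R).
Proof. by apply: lower_semicontinuous_measurable; exact: conjugate_lsc. Qed.

Lemma conjugate_reflect f y : conjugate (fun x => f (- x)%R) y = conjugate f (- y)%R.
Proof.
apply/eqP; rewrite eq_le; apply/andP; split; apply: conjugate_le => x.
  have := conjugate_ub f (- x) (- y); rewrite mulrNN; exact.
by have := conjugate_ub (fun x => f (- x)%R) (- x)%R y; rewrite opprK mulrN mulNr.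
Qed.

Lemma econvex_conjugate f : (forall x, 0 <= f x) -> econvex (conjugate f).
Proof.
move=> f0 y z t /andP[t0 t1]; apply: conjugate_le => x.
case: (f x) (f0 x) (conjugate_ub f x y) (conjugate_ub f x z) => [r|_ _ _|//].
  move=> _ hy hz; rewrite -EFinB.
  have -> : (x * (t * y + (1 - t) * z) - r =
     t * (x * y - r) + (1 - t) * (x * z - r))%R by ring.
  rewrite EFinD !EFinM; apply: leeD; apply: lee_wpmul2l => //.
  by rewrite lee_fin subr_ge0.
by rewrite leNye.
Qed.

End conjugate_theory.

(** * Nonnegative convex functions vanishing at 0 *)

Section nonneg_convex.
Context {R : realType}.
Variable f : R -> \bar R.
Hypotheses (f_ge0 : forall x, 0 <= f x) (f0 : f 0%R = 0) (f_cvx : econvex f).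

Lemma star_convex (t x : R) : (0 <= t <= 1)%R -> f (t * x)%R <= t%:E * f x.
Proof.
move=> t01; have := f_cvx x 0%R t01; rewrite mulr0 addr0 f0 mule0 adde0; exact.
Qed.

Lemma star_convex_le (t x : R) : (0 <= t <= 1)%R -> f (t * x)%R <= f x.
Proof.
move=> /[dup] t01 /andP[t0 t1]; apply: le_trans (star_convex x t01) _.
by rewrite gee_pMl.
Qed.

Lemma star_convex_homo (x y : R) : (0 <= x)%R -> (x <= y)%R -> f x <= f y.
Proof.
move=> x0 xy; have [->|xN0] := eqVneq x 0%R; first by rewrite f0.
have x_gt0 : (0 < x)%R by rewrite lt_def xN0.
have y_gt0 := lt_le_trans x_gt0 xy.
rewrite -{1}(divfK (lt0r_neq0 y_gt0) x); apply: star_convex_le.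
by rewrite divr_ge0 ?(ltW y_gt0)//= ler_pdivrMr// mul1r.
Qed.

(** Monotonicity of the quotient [f x / x], in a form that stays meaningful for infinite values. *)
Lemma star_convex_slope (x y : R) : (0 < x)%R -> (x <= y)%R ->
  (y / x)%:E * f x <= f y.
Proof.
move=> x0 xy; have y0 := lt_le_trans x0 xy.
have := @star_convex (x / y) y; rewrite divfK ?gt_eqF// => h.
have {h} : f x <= (x / y)%:E * f y.
  by apply: h; rewrite divr_ge0 ?(ltW x0) ?(ltW y0)//= ler_pdivrMr// mul1r.
rewrite -(@lee_pmul2l _ (y / x)%:E)//; last by rewrite lte_fin divr_gt0.
by rewrite muleA -EFinM mulrA divfK ?gt_eqF// divff ?gt_eqF// mul1e.
Qed.

Lemma conjugate_ge0 y : 0 <= conjugate f y.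
Proof. by have := conjugate_ub f 0%R y; rewrite mul0r f0 sube0. Qed.

Lemma fenchel_young x y : (x * y)%:E <= f x + conjugate f y.
Proof.
have := conjugate_ub f x y; have := conjugate_ge0 y.
case: (f x) (f_ge0 x) => [r _ _|_|//].
  by rewrite leeBlDl.
by case: (conjugate f y) => // *; rewrite leey.
Qed.

Lemma conjugate0 : conjugate f 0%R = 0.
Proof.
apply/eqP; rewrite eq_le conjugate_ge0 andbT; apply: conjugate_le => x.
by rewrite mulr0 add0e leeNl oppe0.
Qed.

(* For [x > e], convexity gives [f x >= x * (f e / e) >= x * y], so that only
   [x <= e] contributes to the supremum. *)
Lemma conjugate_sublinear : (forall x : R, (0 < x)%R -> 0 < f x) ->
  forall e : R, (0 < e)%R -> exists2 b : R, (0 < b)%R & b%:E <= e^-1%:E * f e /\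
    forall y, (0 <= y <= b)%R -> conjugate f y <= (e * y)%:E.
Proof.
move=> fpos e e0.
have [b b0 bf] : exists2 b : R, (0 < b)%R & b%:E <= e^-1%:E * f e.
  have := fpos _ e0; case: (f e) => [r| |//]; last first.
    by move=> _; exists 1%R => //; rewrite gt0_muley ?leey// lte_fin invr_gt0.
  by rewrite lte_fin => r0; exists (e^-1 * r)%R => //; rewrite mulr_gt0 ?invr_gt0.
exists b => //; split => // y /andP[y0 yb]; apply: conjugate_le => x.
have [xe|/ltW ex] := leP x e.
  apply: (@le_trans _ _ (x * y)%:E); first by rewrite geeDl// leeNl oppe0.
  by rewrite lee_fin ler_wpM2r.
apply: (@le_trans _ _ 0); last by rewrite lee_fin mulr_ge0// ltW.
have xf := star_convex_slope e0 ex.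
rewrite sube_le0; apply: le_trans xf.
rewrite !EFinM -muleA; apply: lee_wpmul2l; first by rewrite lee_fin (le_trans _ ex)// ltW.
by apply: le_trans bf; rewrite lee_fin.
Qed.

End nonneg_convex.

(** * Divergence generators *)

Section divergence_generator_theory.
Context {R : realType}.
Variable phi : R -> \bar R.
Hypothesis hphi : divergence_generator phi.
Local Notation psi := (shift1 phi).

Lemma shift1_ge0 x : 0 <= psi x.
Proof. exact: (dg_ge0 hphi). Qed.

Lemma shift1_0 : psi 0%R = 0.
Proof. by rewrite /shift1 add0r (dg_1 hphi). Qed.

Lemma econvex_shift1 : econvex psi.
Proof.
move=> x y t t01; rewrite /shift1.
have -> : (t * x + (1 - t) * y + 1 = t * (x + 1) + (1 - t) * (y + 1))%R by ring.
exact: (dg_convex hphi).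
Qed.

Local Notation psi_ge0 := shift1_ge0.
Local Notation psi_cvx := econvex_shift1.
Local Notation psi0 := shift1_0.

Lemma shift1_reflect_ge0 x : 0 <= psi (- x)%R.
Proof. exact: (dg_ge0 hphi). Qed.

Lemma shift1_reflect0 : psi (- 0)%R = 0.
Proof. by rewrite oppr0 psi0. Qed.

Lemma econvex_shift1_reflect : econvex (fun x => psi (- x)%R).
Proof.
move=> x y t t01; rewrite opprD -2!mulrN; exact: psi_cvx.
Qed.

Lemma measurable_generator : measurable_fun setT phi.
Proof. by apply: lower_semicontinuous_measurable; exact: (dg_lsc hphi). Qed.

(** As [psi] is infinite below -1, only [x >= -1] contributes, and there [x * y <= - y]. Hence psi^*
    of an integrable function has an integrable negative side, whatever [phi] is. *)
Lemma conjugate_shift1_le y : (y <= 0)%R -> conjugate psi y <= (- y)%:E.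
Proof.
move=> y0; apply: conjugate_le => x.
have [x1|x1] := ltP x (-1)%R.
  by rewrite /shift1 (dg_neg hphi)/= ?addeNy ?leNye// -ltrBrDr sub0r.
apply: (@le_trans _ _ (x * y)%:E); first by rewrite geeDl// oppe_le0 (dg_ge0 hphi).
rewrite lee_fin -mulN1r; exact: ler_wnM2r.
Qed.

(** If [psi] vanished at some [x > 0] and at some [- z < 0], monotonicity away from 0 would make it
    vanish on [[- z, x]], and 1 would be interior to the zero set of [phi]. *)
Lemma shift1_dichotomy : ~ ([set x | phi x = 0])° 1%R ->
  (forall x : R, (0 < x)%R -> 0 < psi x) \/
  (forall x : R, (0 < x)%R -> 0 < psi (- x)%R).
Proof.
move=> h; apply: contrapT => /not_orP[].
move=> /existsNP[x /not_implyP[x0 /negP]]; rewrite -leNgt => fx0.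
move=> /existsNP[z /not_implyP[z0 /negP]]; rewrite -leNgt => fz0.
apply: h; exists (Num.min x z) => /=; first by rewrite lt_min x0.
move=> w /=; rewrite lt_min => /andP[wx wz].
have -> : w = ((w - 1) + 1)%R by rewrite subrK.
apply/eqP; rewrite eq_le (dg_ge0 hphi) andbT.
have [w1|w1] := leP 1%R w.
  apply: le_trans fx0; apply: (star_convex_homo psi_ge0 psi0 psi_cvx).
    by rewrite subr_ge0.
  by move: wx; rewrite distrC ger0_norm ?subr_ge0// => /ltW.
apply: le_trans fz0.
have := @star_convex_homo _ _ shift1_reflect_ge0 shift1_reflect0
  econvex_shift1_reflect (1 - w)%R z.
rewrite opprB; apply; first by rewrite subr_ge0 ltW.
by move: wz; rewrite gtr0_norm ?subr_gt0// => /ltW.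
Qed.

(** The linear cost of scaling [nu] down by [1 - e]. [C] is the slope of the chord of [phi] over
    [[1 - r / 2, 1]], where [r] is the radius of a ball around 1 inside the domain. *)
Lemma generator_near1 : exists C b : R, [/\ (0 <= C)%R, (0 < b)%R &
  forall e, (0 <= e <= b)%R -> phi (1 - e)%R <= (C * e)%:E].
Proof.
have [r /= r0 rdom] := dg_nbhs1 hphi.
have r20 : (0 < r / 2)%R by rewrite divr_gt0.
have : phi (1 - r / 2)%R < +oo.
  apply: rdom; rewrite /= opprB addrC subrK gtr0_norm//.
  by rewrite ltr_pdivrMr// mulr2n mulrDr mulr1 ltrDl.
have := dg_ge0 hphi (1 - r / 2)%R.
case E : (phi _) => [a| |]// a0 _.
exists (a / (r / 2))%R, (r / 2)%R; split => //; first by rewrite divr_ge0// ltW.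
move=> e /andP[e0 er].
have := @star_convex _ _ shift1_reflect0 econvex_shift1_reflect (e / (r / 2))%R (r / 2)%R.
rewrite divfK ?gt_eqF// /shift1 ![(- _ + 1)%R]addrC E => h.
apply: (le_trans (h _)); last first.
  by rewrite -EFinM lee_fin mulrAC (mulrC e) mulrAC.
by rewrite divr_ge0 ?(ltW r20)//= ler_pdivrMr// mul1r.
Qed.

(** Clamping at 1 is needed for monotonicity: at and below 1 the quotient [phi z / z] need not
    increase, since [phi] vanishes at 1. *)
Let quot z := phi (Num.max 1%R z) * ((Num.max 1%R z)^-1)%:E.

Let quot_nd : nondecreasing_fun quot.
Proof.
suff h (x y : R) : (1 <= x)%R -> (x <= y)%R -> phi x * x^-1%:E <= phi y * y^-1%:E.
  move=> x y xy; apply: h; first by rewrite le_max lexx.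
  by rewrite ge_max le_max lexx/= le_max xy orbT.
move=> x1 xy; have x0 := lt_le_trans ltr01 x1; have y0 := lt_le_trans x0 xy.
have y1 := le_trans x1 xy.
have [->|xN1] := eqVneq x 1%R.
  by rewrite (dg_1 hphi) mul0e mule_ge0 ?(dg_ge0 hphi)// lee_fin invr_ge0 ltW.
have x1' : (1 < x)%R by rewrite lt_def xN1.
have y1' := lt_le_trans x1' xy.
rewrite lee_pdivrMr// -muleA -EFinM mulrC.
(* The chord from 1 gives [phi x <= (x - 1) / (y - 1) * phi y], and this ratio is at most [x / y]
   because [x <= y]. *)
have := @star_convex _ _ psi0 psi_cvx ((x - 1) / (y - 1))%R (y - 1)%R.
rewrite divfK ?subr_eq0 ?gt_eqF// /shift1 !subrK => h.
apply: (le_trans (h _)).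
  rewrite divr_ge0 ?subr_ge0//= ler_pdivrMr ?subr_gt0// mul1r.
  by rewrite lerD2r.
rewrite muleC; apply: lee_wpmul2l; first exact: (dg_ge0 hphi).
rewrite lee_fin ler_pdivrMr ?subr_gt0// mulrAC ler_pdivlMr//.
have : (x * y - y <= x * y - x)%R by rewrite lerD2l lerN2.
by rewrite mulrBl mulrBr mul1r mulr1.
Qed.

Lemma slope_pinftyE : slope_pinfty phi = ereal_sup (range quot).
Proof.
apply/cvg_lim => //; have := nondecreasing_cvge quot_nd.
apply: cvg_trans; apply: near_eq_cvg; near=> z.
rewrite /quot; have /max_idPr -> // : (1 <= z)%R.
by near: z; exact: nbhs_pinfty_ge.
Unshelve. all: by end_near. Qed.

Lemma slope_pinfty_ub z : (1 <= z)%R -> phi z * z^-1%:E <= slope_pinfty phi.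
Proof.
move=> z1; rewrite slope_pinftyE; apply: ereal_sup_ubound.
by exists z => //; rewrite /quot; have /max_idPr -> // := z1.
Qed.

Lemma slope_pinfty_ge0 : 0 <= slope_pinfty phi.
Proof.
apply: le_trans (slope_pinfty_ub (lexx _)).
by rewrite mule_ge0 ?(dg_ge0 hphi)// lee_fin invr_ge0.
Qed.

(** For [z >= x], the quotient bound gives [psi x <= x / z * psi z], and [psi z = phi (z + 1)] is at
    most [c * (z + 1)]. The resulting excess [c * x / z] vanishes as [z] grows. *)
Lemma shift1_le_slope x : (0 <= x)%R -> psi x <= slope_pinfty phi * x%:E.
Proof.
rewrite le_eqVlt => /predU1P[<-|x0]; first by rewrite psi0 mule0.
have := slope_pinfty_ge0; case E : (slope_pinfty phi) => [c| |]// c0; last first.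
  by rewrite gt0_mulye ?leey// lte_fin.
rewrite lee_fin in c0.
have h (z : R) : (x <= z)%R -> psi x <= (c * x + c * x / z)%:E.
  move=> xz; have z0 := lt_le_trans x0 xz.
  have := star_convex_slope psi0 psi_cvx x0 xz.
  have z1 : (1 <= z + 1)%R by rewrite lerDr ltW.
  have := slope_pinfty_ub z1; rewrite E.
  rewrite lee_pdivrMr//; last by rewrite ltr_wpDr.
  move=> h1 h2; have {h1 h2} := le_trans h2 h1.
  rewrite -(@lee_pmul2l _ (x / z)%:E)//; last by rewrite lte_fin divr_gt0.
  rewrite muleA -EFinM mulrA divfK ?gt_eqF// divff ?gt_eqF// mul1e => /le_trans; apply.
  rewrite -!EFinM lee_fin le_eqVlt; apply/orP; left; apply/eqP.
  by field; rewrite gt_eqF.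
apply/lee_addgt0Pr => e e0.
have [cx0|cx0] := eqVneq c 0%R.
  by apply: (le_trans (h _ (lexx _))); rewrite cx0 !mul0r mul0e add0e lee_fin add0r ltW.
have cp : (0 < c)%R by rewrite lt_def cx0.
(* This [z] makes the excess [c * x / z] at most [e]. *)
set z := Num.max x (c * x / e)%R.
have xz : (x <= z)%R by rewrite le_max lexx.
apply: (le_trans (h _ xz)); rewrite -EFinM -EFinD lee_fin lerD2l.
rewrite ler_pdivrMr ?(lt_le_trans x0)// -ler_pdivrMl// mulrC.
by rewrite le_max lexx orbT.
Qed.

Lemma shift1_superlinear K : slope_pinfty phi = +oo ->
  exists2 x : R, (0 < x)%R & (K * x)%:E < psi x.
Proof.
move=> soo; have : (Num.max K 1)%:E < ereal_sup (range quot).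
  by rewrite -slope_pinftyE soo ltry.
(* The maximum with 1 keeps the factor positive, so that replacing [w] by [w - 1] only lowers the
   linear side; it also rules out [w = 1], where [phi] is 0. *)
move=> /ereal_sup_gt[_ [z _ <-]]; rewrite /quot; set w := Num.max _ z => h.
have w1 : (1 <= w)%R by rewrite le_max lexx.
have w0 := lt_le_trans ltr01 w1.
have [w1'|wN1] := eqVneq w 1%R.
  by move: h; rewrite w1' (dg_1 hphi) mul0e lte_fin gt_max ltr10 andbF.
exists (w - 1)%R; first by rewrite subr_gt0 lt_def wN1.
rewrite /shift1 subrK; move: h; rewrite lte_pdivlMr//.
apply: le_lt_trans; rewrite -EFinM lee_fin.
apply: (@le_trans _ _ (Num.max K 1 * (w - 1)))%R.
  by rewrite ler_wpM2r ?subr_ge0// le_max lexx.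
by rewrite ler_wpM2l ?gerBl// le_max ler01 orbT.
Qed.

End divergence_generator_theory.

(** * Lebesgue decomposition *)

Section signed_measure_theory.
Context d (T : measurableType d) (R : realType).

(** Whichever Hahn decomposition has been chosen, its negative set is null for a nonnegative
    charge. *)
Lemma neg_part_eq0 (mu : {charge set T -> \bar R}) A :
  (forall B, measurable B -> 0 <= mu B) -> measurable A -> neg_part mu A = 0.
Proof.
move=> mu0 mA; rewrite /neg_part; case: (hahn_sets mu) => -[P N] /= h.
have [_ [mN negN] _ _] := h.
rewrite jordan_negE cjordan_negE /crestr0 mem_set// /crestr.
have mAN : measurable (A `&` N) by exact: measurableI.
have -> : mu (A `&` N) = 0; last by rewrite oppe0.
apply/eqP; rewrite eq_le mu0// andbT negN//.
Qed.

Lemma pos_part_id (mu : {charge set T -> \bar R}) A :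
  (forall B, measurable B -> 0 <= mu B) -> measurable A -> pos_part mu A = mu A.
Proof.
move=> mu0 mA; have := neg_part_eq0 mu0 mA; rewrite /neg_part /pos_part => n0.
rewrite [RHS](jordan_decomp (svalP (hahn_sets mu)) mA) /cadd /= cscaleN1.
by rewrite [X in _ - X]n0 sube0.
Qed.

Lemma variation_id (mu : {charge set T -> \bar R}) A :
  (forall B, measurable B -> 0 <= mu B) -> measurable A -> Defs.variation mu A = mu A.
Proof.
move=> mu0 mA; rewrite -[RHS]pos_part_id// -[RHS]adde0 -(neg_part_eq0 mu0 mA).
by [].
Qed.

Lemma variation_probability (P : probability T R) A : measurable A ->
  Defs.variation (charge_of_finite_measure P) A = P A.
Proof. by move=> mA; rewrite variation_id. Qed.

(** The decomposition comes from an abstract choice; this recovers its parts as restrictions of [P]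
    to [N] and to its complement. The singular part vanishes off [N] because its variation does, the
    other part vanishes inside [N] because [N] is [nu]-null. *)
Lemma singular_carrier (P nu : probability T R) : exists N,
  [/\ measurable N, nu N = 0,
      forall A, measurable A ->
        sing_part nu (charge_of_finite_measure P) A = P (A `&` N),
      forall A, measurable A ->
        ac_part nu (charge_of_finite_measure P) A = P (A `&` ~` N) &
      ac_part nu (charge_of_finite_measure P) `<< nu].
Proof.
rewrite /sing_part /ac_part.
case: (cid _) => -[mc ms] /= [Pcs mcnu [N [mN nuN0 varN]]].
have mNC : measurable (~` N) by exact: measurableC.
have sC A : measurable A -> ms (A `&` ~` N) = 0.
  move=> mA; have mAN : measurable (A `&` ~` N) by exact: measurableI.
  apply/eqP; rewrite -abse_eq0 eq_le abse_ge0 andbT.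
  apply: le_trans (abse_charge_variation (svalP (hahn_sets ms)) mAN) _.
  rewrite -varN; apply: (@le_measure _ _ _ (Defs.variation ms)); rewrite ?inE//.
have cN A : measurable A -> mc (A `&` N) = 0.
  move=> mA; have mAN : measurable (A `&` N) by exact: measurableI.
  move/null_content_dominatesP : mcnu; apply => //.
  by apply/eqP; rewrite eq_le measure_ge0 andbT -nuN0 le_measure ?inE.
exists N; split => // A mA.
- rewrite (chargeDI ms mA mN) setDE sC// add0e.
  have := Pcs (A `&` N) (measurableI _ _ mA mN).
  by rewrite cN// add0e => <-.
- rewrite (chargeDI mc mA mN) setDE cN// adde0.
  have := Pcs (A `&` ~` N) (measurableI _ _ mA mNC).
  by rewrite sC// adde0 => <-.
Qed.

Lemma density_change_of_variables (P : {finite_measure set T -> \bar R})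
    (nu : probability T R) (p : T -> \bar R) :
  measurable_fun setT p -> (forall x, 0 <= p x) ->
  (forall A, measurable A -> P A = \int[nu]_(x in A) p x) ->
  forall u : T -> \bar R, measurable_fun setT u -> (forall x, 0 <= u x) ->
  \int[P]_x u x = \int[nu]_x (u x * p x).
Proof.
move=> mp p0 Pp u mu u0.
have Pnu : P `<< nu.
  apply/null_content_dominatesP => A mA A0; rewrite Pp//.
  by apply: null_set_integral => //; exact: measurable_funTS.
rewrite -(Radon_Nikodym_SigmaFinite.change_of_variables Pnu)//.
have fi := Radon_Nikodym_SigmaFinite.f_integrable Pnu.
have mf := measurable_int _ fi.
apply: ae_eq_integral => //; [exact: emeasurable_funM..|].
apply: ae_eqe_mul2l; apply: integral_ae_eq => // E _ mE.
by rewrite -Radon_Nikodym_SigmaFinite.f_integral// Pp.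
Qed.

(* [N] carries the singular part of [P] and [f] is a version of the density of
   its absolutely continuous part. *)
Lemma phi_divergenceE (phi : R -> \bar R) (P nu : probability T R) :
  divergence_generator phi ->
  exists N (f : T -> R), [/\ measurable N, nu N = 0,
    measurable_fun setT f, (forall x, 0 <= f x)%R &
    [/\ forall u : T -> \bar R, measurable_fun setT u -> (forall x, 0 <= u x) ->
      \int[P]_(x in ~` N) u x = \int[nu]_x (u x * (f x)%:E),
      forall A, measurable A -> P (A `&` ~` N) = \int[nu]_(x in A) (f x)%:E &
     phi_divergence phi (charge_of_finite_measure P) nu =
      \int[nu]_x phi (f x) + P N * slope_pinfty phi]].
Proof.
move=> hphi; have [N [mN nuN0 sE cE cnu]] := singular_carrier P nu.
have mNC : measurable (~` N) by exact: measurableC.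
pose Pc : {finite_measure set T -> \bar R} := mrestr P mNC.
have Pcnu : Pc `<< nu.
  apply/null_content_dominatesP => A mA A0.
  have /null_content_dominatesP h := cnu.
  by have := h _ mA A0; rewrite cE.
pose F := Radon_Nikodym_SigmaFinite.f Pc nu.
have F0 x : 0 <= F x by exact: Radon_Nikodym_SigmaFinite.f_ge0.
have Ffin x : F x \is a fin_num by exact: Radon_Nikodym_SigmaFinite.f_fin_num.
have Fi : nu.-integrable setT F by exact: Radon_Nikodym_SigmaFinite.f_integrable.
have mF := measurable_int _ Fi.
have mphi := measurable_generator hphi.
exists N, (fine \o F); split => //.
- exact: measurableT_comp.
- by move=> x; exact: fine_ge0.
split.
- move=> u mu u0; under [RHS]eq_integral do rewrite fineK//.
  rewrite (Radon_Nikodym_SigmaFinite.change_of_variables Pcnu)//.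
  have mu' D : measurable_fun D u by exact: measurable_funTS.
  rewrite -(setUv N) ge0_integral_setU//; last exact/disj_setPCl.
  rewrite [X in _ = X + _]null_set_integral//; last first.
    by rewrite /Pc/= /mrestr setICr measure0.
  rewrite add0e; apply: eq_measure_integral => A mA AN.
  by rewrite /Pc/= /mrestr (setIidl AN).
- move=> A mA; under eq_integral do rewrite fineK//.
  by rewrite -Radon_Nikodym_SigmaFinite.f_integral.
rewrite /phi_divergence.
have sing0 B : measurable B -> 0 <= sing_part nu (charge_of_finite_measure P) B.
  by move=> mB; rewrite sE.
rewrite neg_part_eq0// mul0e sube0 pos_part_id// sE// setTI; congr (_ + _).
have mRN : measurable_fun setT (Radon_Nikodym (ac_part nu (charge_of_finite_measure P)) nu).
  by apply: (@measurable_int _ _ _ nu); exact: Radon_Nikodym_integrable.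
apply: ae_eq_integral => //.
- by apply: (measurableT_comp mphi); exact: measurableT_comp.
- by apply: (measurableT_comp mphi); exact: measurableT_comp.
have : ae_eq nu setT F (Radon_Nikodym (ac_part nu (charge_of_finite_measure P)) nu).
  apply: integral_ae_eq => // E _ mE.
  rewrite -(Radon_Nikodym_integral cnu)// cE//.
  by rewrite -Radon_Nikodym_SigmaFinite.f_integral.
by apply: filterS => x /(_ Logic.I) Fx _ /=; rewrite Fx.
Qed.

End signed_measure_theory.

(** * Essential range modulo an ideal *)

Section essential_range.
Context d (T : measurableType d) (R : realType).
Variables (Xi : set (set T)) (hXi : sigma_ideal Xi).
Variables (f : T -> R) (mf : measurable_fun setT f).

(* Lindelof: [f @^-1` U] is covered by the countably many sets
   [f @^-1` `]p, q[] with rational end points that lie in [Xi]. *)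
Lemma ideal_preimage (U : set R) : measurable U ->
  (forall x, U x -> ~ ess_im Xi f x) -> Xi (f @^-1` U).
Proof.
move=> mU UN.
pose F n := match (unpickle n : option (rat * rat)) with
  | Some (p, q) => if `[< Xi (f @^-1` `](ratr p : R), (ratr q : R)[) >]
                   then f @^-1` `](ratr p : R), (ratr q : R)[ else set0
  | None => set0 end.
have XF n : Xi (F n).
  rewrite /F; case: (unpickle n) => [[p q]|]; last exact: sigma_ideal0.
  by case: asboolP => // _; exact: sigma_ideal0.
apply: (sigma_idealS hXi (sigma_ideal_bigcup hXi XF)).
  by rewrite -[_ @^-1` _]setTI; exact: mf.
move=> x /UN /existsNP[e /not_implyP[/= e0 /contrapT Xe]].
have /rat_in_itvoo[p] : (f x - e < f x)%R by rewrite gtrBl.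
rewrite in_itv/= => /andP[ep pf].
have /rat_in_itvoo[q] : (f x < f x + e)%R by rewrite ltrDl.
rewrite in_itv/= => /andP[fq qe].
have Xpq : Xi (f @^-1` `](ratr p : R), (ratr q : R)[).
  apply: (sigma_idealS hXi Xe).
    by rewrite -[_ @^-1` _]setTI; apply: mf.
  move=> z /=; rewrite !in_itv/= => /andP[pz zq].
  by rewrite (lt_trans ep pz) (lt_trans zq qe).
exists (pickle (p, q)); first exact: Logic.I.
rewrite /F pickleK; case: asboolP => [_|/(_ Xpq)[]].
by rewrite /= in_itv/= pf fq.
Qed.

Lemma ess_im_preimage (U : set R) x : open U -> Xi (f @^-1` U) -> U x ->
  ~ ess_im Xi f x.
Proof.
move=> oU XU Ux /= ess.
have [e /= e0 eU] : nbhs x U by exact: open_nbhs_nbhs.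
apply: (ess e e0); apply: (sigma_idealS hXi XU).
  by rewrite -[_ @^-1` _]setTI; apply: mf.
move=> z /=; rewrite in_itv/= => /andP[xz zx]; apply: eU => /=.
by rewrite ltr_distlC xz zx.
Qed.

(** Replaces the essential range by a null-set condition, the form in which the constraint of the
    cumulant is used throughout. *)
Lemma ideal_ess_sup_le (c : R) :
  ideal_ess_sup Xi f <= c%:E <-> Xi [set x | (c < f x)%R].
Proof.
split=> [fc|Xc].
  have -> : [set x | (c < f x)%R] = f @^-1` `]c, +oo[.
    by apply/seteqP; split=> x /=; rewrite in_itv/= andbT.
  apply: ideal_preimage => // x /=; rewrite in_itv/= andbT => cx fx.
  suff : x%:E <= c%:E by rewrite lee_fin leNgt cx.
  by apply: le_trans fc; apply: ereal_sup_ubound; exists x.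
apply: ge_ereal_sup => _ [x fx <-]; rewrite lee_fin leNgt; apply/negP => cx.
by apply: (@ess_im_preimage [set y | (c < y)%R] x) fx => //; exact: open_gt.
Qed.

End essential_range.

(** * The ideal of sets null for all measures integrating [g] *)

Section Xspace_theory.
Context d (T : measurableType d) (R : realType).
Variables (Sigma : set (set T)) (g : T -> R).
Hypothesis mg : measurable_fun setT g.
Local Notation Xi := (null_of_Xspace Sigma g).

Lemma sigma_ideal_null_of_Xspace : sigma_ideal Xi.
Proof.
split.
- by move=> A [].
- by split=> // mu _; exact: (@measure0 _ _ _ (Defs.variation mu)).
- move=> A B [mA A0] mB BA; split => // mu /A0 muA.
  apply/eqP; rewrite eq_le (@measure_ge0 _ _ _ (Defs.variation mu)) andbT -muA.
  by apply: (@le_measure _ _ _ (Defs.variation mu)); rewrite ?inE.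
- move=> F XF; split.
    by apply: bigcupT_measurable => n; have [] := XF n.
  move=> mu Xmu; apply: (@measure_negligible _ _ _ (Defs.variation mu)).
    by apply: bigcupT_measurable => n; have [] := XF n.
  apply: negligible_bigcup => n; have [mF /(_ _ Xmu) F0] := XF n.
  by apply/(@negligibleP _ _ _ (Defs.variation mu)).
Qed.

Lemma Xspace1P (P : probability T R) : (Sigma `<=` measurable) ->
  Xspace1 Sigma g P <->
  (forall A, Sigma A -> P A = 0) /\ P.-integrable setT (EFin \o g).
Proof.
move=> mSigma; rewrite /Xspace1 /Xspace /=.
have -> : (\int[Defs.variation (charge_of_finite_measure P)]_x `|g x|%:E) =
    \int[P]_x `|g x|%:E.
  by apply: eq_measure_integral => A mA _; exact: variation_probability.
split=> -[S0 ig]; split.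
- by move=> A SA; rewrite -variation_probability ?S0//; exact: mSigma.
- by apply/integrableP; split => //; exact/measurable_EFinP.
- by move=> A SA; rewrite variation_probability ?S0//; exact: mSigma.
- by have /integrableP[] := ig.
Qed.

Lemma null_of_Xspace_null (P : probability T R) A : Xspace1 Sigma g P ->
  Xi A -> P A = 0.
Proof. by move=> XP [mA /(_ _ XP)]; rewrite variation_probability. Qed.

Lemma XspaceN : Xspace Sigma (fun x => - g x)%R = Xspace Sigma g.
Proof.
have E mu : \int[Defs.variation mu]_x `|- g x|%:E = \int[Defs.variation mu]_x `|g x|%:E.
  by apply: eq_integral => x _; rewrite normrN.
by rewrite /Xspace; apply/seteqP; split=> mu /= [? h]; split=> //; rewrite ?E// -E.
Qed.

Lemma null_of_XspaceN : null_of_Xspace Sigma (fun x => - g x)%R = Xi.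
Proof. by rewrite /null_of_Xspace XspaceN. Qed.

Lemma in_LinftyP : in_Linfty Xi g <->
  (exists n : nat, Xi [set x | (n%:R < g x)%R]) /\
  (exists n : nat, Xi [set x | (n%:R < - g x)%R]).
Proof.
have hXi := sigma_ideal_null_of_Xspace; split.
  move=> [_ [M0 [_ hM]]].
  (* [bounded_set] only bounds the range by numbers strictly above [M0], hence [M0 + 1]. *)
  set M : R := Num.max (M0 + 1)%R 0%R.
  have MM x : ess_im Xi g x -> (`|x| <= M)%R.
    by apply: hM; rewrite lt_max ltrDl ltr01.
  have Mn : (M < (Num.truncn M).+1%:R)%R by exact: truncnS_gt.
  have out x : ((Num.truncn M).+1%:R < `|x|)%R -> ~ ess_im Xi g x.
    by move=> nx /MM; rewrite leNgt (lt_trans Mn nx).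
  split; exists (Num.truncn M).+1.
  - have -> : [set x | ((Num.truncn M).+1%:R < g x)%R] =
        g @^-1` `](Num.truncn M).+1%:R, +oo[.
      by apply/seteqP; split=> x /=; rewrite in_itv/= andbT.
    apply: ideal_preimage => // x /=; rewrite in_itv/= andbT => nx.
    by apply: out; rewrite (lt_le_trans nx)// ler_norm.
  - have -> : [set x | ((Num.truncn M).+1%:R < - g x)%R] =
        g @^-1` `]-oo, (- (Num.truncn M).+1%:R)%R[.
      by apply/seteqP; split=> x /=; rewrite in_itv/= ltrNr.
    apply: ideal_preimage => // x /=; rewrite in_itv/= ltrNr => nx.
    by apply: out; rewrite (lt_le_trans nx)// -normrN ler_norm.
move=> [[n Xn] [m Xm]]; split=> //.
exists (n + m)%:R; split; first by rewrite num_real.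
move=> M /= nmM x ess; rewrite leNgt; apply/negP => Mx.
have [xn|xn] := ltP (n%:R : R) x.
  by apply: (@ess_im_preimage _ _ _ _ hXi _ mg [set y | (n%:R < y)%R] x) ess
    => //; exact: open_gt.
have om : open [set y : R | (y < - m%:R)%R] by exact: open_lt.
apply: (ess_im_preimage hXi mg om _ _ ess).
- by move: Xm; congr (Xi _); apply/seteqP; split=> y /=; rewrite ltrNr.
- rewrite /= ltrNr; move: (lt_trans nmM Mx); rewrite natrD.
  have := ler0n R n; have := ler0n R m.
  by case: (lerP 0 x) => x0; rewrite ?(ger0_norm x0) ?(ltr0_norm x0); lra.
Qed.

End Xspace_theory.

(** * Small integrals by dominated convergence *)

Section small_integrals.
Context {R : realType}.

Lemma nneg_cvge0P (a : (\bar R)^nat) : (forall n, 0 <= a n) ->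
  a n @[n --> \oo] --> 0 <->
  forall e : R, (0 < e)%R -> \forall n \near \oo, a n <= e%:E.
Proof.
move=> a0; split=> [|h].
  move=> /fine_cvgP[afin /cvgr0Pnorm_le acv] e e0.
  have := acv e e0; apply: filterS2 afin => n an; rewrite /= ger0_norm ?fine_ge0//.
  by rewrite -{2}(fineK an) lee_fin.
apply/fine_cvgP; split.
  have := h 1%R ltr01; apply: filterS => n an.
  by rewrite ge0_fin_numE ?(le_lt_trans an) ?ltry.
apply/cvgr0Pnorm_le => e e0; have := h _ e0; apply: filterS => n an.
rewrite /= ger0_norm ?fine_ge0// -lee_fin fineK//.
by rewrite ge0_fin_numE ?(le_lt_trans an) ?ltry.
Qed.

Lemma integral_probability_cst d (T : measurableType d) (P : probability T R) (r : R) :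
  \int[P]_x r%:E = r%:E.
Proof.
by rewrite integral_cst// [X in _ * X](_ : _ = 1) ?mule1//; exact: probability_setT.
Qed.

Context d (T : measurableType d) (nu : {measure set T -> \bar R}).

Lemma integrable_posneg (g : T -> R) : measurable_fun setT g ->
  \int[nu]_x (Num.max (g x) 0)%:E < +oo -> \int[nu]_x (Num.max (- g x) 0)%:E < +oo ->
  nu.-integrable setT (EFin \o g).
Proof.
move=> mg gpos gneg; have mpos : measurable_fun setT (fun x => (Num.max (g x) 0)%:E).
  by apply/measurable_EFinP; exact: measurable_maxr.
have mneg : measurable_fun setT (fun x => (Num.max (- g x) 0)%:E).
  by apply/measurable_EFinP; apply: measurable_maxr => //; exact: measurableT_comp.
apply/integrableP; split; first exact/measurable_EFinP.
apply: (@le_lt_trans _ _ (\int[nu]_x ((Num.max (g x) 0)%:E + (Num.max (- g x) 0)%:E))).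
  apply: ge0_le_integral => //.
  - by apply/measurable_EFinP; exact: measurableT_comp.
  - exact: emeasurable_funD.
  move=> x _; rewrite -EFinD lee_fin; have [g0|/ltW g0] := leP 0%R (g x).
    have /max_idPr -> : (- g x <= 0)%R by rewrite oppr_le0.
    by rewrite addr0 ger0_norm.
  have /max_idPl -> : (0 <= - g x)%R by rewrite oppr_ge0.
  by rewrite ler0_norm// add0r.
rewrite ge0_integralD//; last 2 first.
- by move=> x _; rewrite lee_fin le_max lexx orbT.
- by move=> x _; rewrite lee_fin le_max lexx orbT.
by rewrite lte_add_pinfty.
Qed.

Lemma dominated_small_integral (f_ : (T -> \bar R)^nat) (F : T -> \bar R) :
  (forall n, measurable_fun setT (f_ n)) -> measurable_fun setT F ->
  (forall n x, 0 <= f_ n x <= F x) -> \int[nu]_x F x < +oo ->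
  (forall x (e : R), (0 < e)%R -> \forall n \near \oo, f_ n x <= e%:E) ->
  forall e : R, (0 < e)%R -> exists n, \int[nu]_x f_ n x <= e%:E.
Proof.
move=> mf mF fF iF f0 e e0.
have f_ge0 n x : 0 <= f_ n x by have /andP[] := fF n x.
have F0 x : 0 <= F x by have /andP[] := fF 0%N x; exact: le_trans.
have [] := @dominated_convergence _ _ _ nu setT measurableT f_ (cst 0) F.
- exact: mf.
- exact: measurable_cst.
- by apply: aeW => x _; apply/nneg_cvge0P => // e' e'0; exact: f0.
- apply/integrableP; split => //; under eq_integral do rewrite gee0_abs//.
  exact: iF.
- by apply: aeW => x n _; have /andP[? ?] := fF n x; rewrite gee0_abs.
rewrite integral0 => _ _ /nneg_cvge0P h.
have {}h := h (fun n => integral_ge0 _ (fun x _ => f_ge0 n x)).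
by have [N _ /(_ N (leqnn N))] := h e e0; exists N.
Qed.

(* The functions [u (th * v x) / th] decrease with [th] by convexity and tend to
   [0] pointwise. *)
Lemma sublinear_small_integral (u : R -> \bar R) (v : T -> R) (th1 : R) :
  (forall x, 0 <= u x) -> u 0%R = 0 -> econvex u ->
  measurable_fun setT u ->
  (forall e : R, (0 < e)%R -> exists2 b : R, (0 < b)%R &
    forall y : R, (0 <= y <= b)%R -> u y <= (e * y)%:E) ->
  measurable_fun setT v -> (forall x, 0 <= v x)%R -> (0 < th1)%R ->
  \int[nu]_x u (th1 * v x)%R < +oo ->
  forall e : R, (0 < e)%R -> exists2 th : R, (0 < th <= th1)%R &
    \int[nu]_x u (th * v x)%R <= (e * th)%:E.
Proof.
move=> u0 u_0 ucvx mu usub mv v0 th10 iu e e0.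
pose th (n : nat) : R := (th1 / n.+1%:R)%R.
have th0 n : (0 < th n)%R by rewrite divr_gt0.
have muv t : measurable_fun setT (fun x => u (t * v x)%R).
  by apply: measurableT_comp => //; exact: measurable_funM.
have thE n : th n = (n.+1%:R^-1 * th1)%R by rewrite mulrC.
have [] := @dominated_small_integral (fun n x => (th n)^-1%:E * u (th n * v x)%R)
  (fun x => th1^-1%:E * u (th1 * v x)%R) _ _ _ _ _ e e0.
- by move=> n; exact: measurable_funeM.
- exact: measurable_funeM.
- move=> n x; rewrite mule_ge0 ?lee_fin ?invr_ge0 ?(ltW (th0 _))//=.
  have := @star_convex _ _ u_0 ucvx n.+1%:R^-1%R (th1 * v x)%R.
  rewrite mulrA -thE => h.
  rewrite lee_pdivrMl// muleA -EFinM.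
  have -> : (th n * th1^-1 = n.+1%:R^-1)%R by rewrite thE mulfK// gt_eqF.
  by apply: h; rewrite invr_ge0 ler0n invf_le1// ler1n.
- rewrite ge0_integralZl_EFin//; last by rewrite invr_ge0 ltW.
  by rewrite lte_mul_pinfty// lee_fin invr_ge0 ltW.
- move=> x e' e'0.
  have e2 : (0 < e' / (v x + 1))%R by rewrite divr_gt0// ltr_wpDl.
  have [b b0 ub] := usub _ e2.
  have : \forall n \near \oo, (th n * v x <= b)%R.
    have : \forall n \near \oo, (th1 * v x / b < n%:R)%R by exact: nbhs_infty_gtr.
    apply: filterS => n; rewrite ltr_pdivrMr// => h.
    rewrite /th mulrAC ler_pdivrMr//; apply: (le_trans (ltW h)).
    by rewrite mulrC ler_pM2l// ler_nat.
  apply: filterS => n thb.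
  rewrite lee_pdivrMl//; apply: (le_trans (ub _ _)).
    by rewrite mulr_ge0 ?(ltW (th0 _)).
  rewrite -EFinM lee_fin mulrCA ler_pM2l//.
  by rewrite mulrAC ler_pdivrMr ?ltr_wpDl// ler_pM2l// lerDl.
move=> n hn; exists (th n).
  by rewrite th0/= ler_pdivrMr// ler_peMr ?(ltW th10)// ler1n.
move: hn; rewrite ge0_integralZl_EFin//; last by rewrite invr_ge0 ltW.
by rewrite lee_pdivrMl// -EFinM mulrC.
Qed.

End small_integrals.

(** * The cumulant generating function *)

Section cumulant_theory.
Context d (T : measurableType d) (R : realType).
Variables (phi : R -> \bar R) (hphi : divergence_generator phi).
Variables (Xi : set (set T)) (hXi : sigma_ideal Xi).
Variables (nu : probability T R) (g : T -> R) (mg : measurable_fun setT g).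
Local Notation psi := (shift1 phi).
Local Notation psis := (conjugate (shift1 phi)).
Local Notation c := (slope_pinfty phi).
Local Notation K := (cumulant phi g nu Xi).

Let psis_ge0 y : 0 <= psis y.
Proof. apply: conjugate_ge0; exact: (shift1_0 hphi). Qed.

Let psis0 : psis 0%R = 0.
Proof. apply: conjugate0; [exact: (shift1_ge0 hphi)|exact: (shift1_0 hphi)]. Qed.

Let psis_cvx : econvex psis.
Proof. by apply: econvex_conjugate; exact: (shift1_ge0 hphi). Qed.

Let measurable_affine t l : measurable_fun setT (fun x => t * g x + l)%R.
Proof. by apply: measurable_funD => //; exact: measurable_funM. Qed.

Let measurable_psis (h : T -> R) : measurable_fun setT h ->
  measurable_fun setT (fun x => psis (h x)).
Proof. by move=> mh; apply: measurableT_comp mh; exact: measurable_conjugate. Qed.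

Lemma cumulant_constraint t l :
  l%:E + ideal_ess_sup Xi (fun x => t * g x)%R <= c <->
  Xi [set x | c < (t * g x + l)%:E].
Proof.
have := slope_pinfty_ge0 hphi; case: c => [r _|_|//].
  rewrite addeC -leeBrDr// -EFinB ideal_ess_sup_le//; last exact: measurable_funM.
  by under eq_set do rewrite ltrBlDr -lte_fin.
rewrite leey; split => // _; rewrite (_ : mkset _ = set0); first exact: sigma_ideal0.
by apply/seteqP; split.
Qed.

Lemma cumulant_le t l : Xi [set x | c < (t * g x + l)%:E] ->
  K t <= \int[nu]_x psis (t * g x + l)%R.
Proof.
by move=> /cumulant_constraint tl; apply: ereal_inf_lbound; exists l.
Qed.

Lemma cumulant_lt t a : K t < a -> exists2 l,
  Xi [set x | c < (t * g x + l)%:E] & \int[nu]_x psis (t * g x + l)%R < a.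
Proof.
by move=> /ereal_inf_lt[_ [l /= /cumulant_constraint tl <-]]; exists l.
Qed.

Lemma ideal_affineW t l t' l' :
  (forall x, (t * g x + l)%:E <= c -> (t' * g x + l')%:E <= c) ->
  Xi [set x | c < (t * g x + l)%:E] -> Xi [set x | c < (t' * g x + l')%:E].
Proof.
move=> h Xtl; apply: (sigma_idealS hXi Xtl).
  rewrite -[X in measurable X]setTI; apply: emeasurable_fun_o_infty => //.
  exact/measurable_EFinP.
by move=> x /=; apply: contraTT; rewrite -!leNgt; exact: h.
Qed.

Lemma slope_scale (th y : R) : (0 <= th <= 1)%R -> y%:E <= c -> (th * y)%:E <= c.
Proof.
move=> /andP[th0 th1] yc; have [y0|y0] := leP 0%R y.
  by apply: le_trans yc; rewrite lee_fin ler_piMl.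
apply: le_trans (slope_pinfty_ge0 hphi).
by rewrite lee_fin mulr_ge0_le0// ltW.
Qed.

Lemma cumulant_ge0 t : 0 <= K t.
Proof. by apply: le_ereal_inf_tmp => _ [l _ <-]; exact: integral_ge0. Qed.

Lemma cumulant0 : K 0%R = 0.
Proof.
apply/eqP; rewrite eq_le cumulant_ge0 andbT.
have := @cumulant_le 0%R 0%R.
under eq_set do rewrite mul0r addr0.
under eq_integral do rewrite mul0r addr0 psis0.
rewrite integral0; apply.
rewrite (_ : mkset _ = set0); first exact: sigma_ideal0.
apply/seteqP; split=> // x /=.
by rewrite ltNge (slope_pinfty_ge0 hphi).
Qed.

(** The multiplier is scaled together with [t]: [th * l] is admissible at [th * t] because the slope
    [c] is nonnegative, and convexity of psi^* with psi^*(0) = 0 brings out the factor [th]. *)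
Lemma cumulant_scale (th t : R) : (0 <= th <= 1)%R -> K (th * t) <= th%:E * K t.
Proof.
move=> /[dup] th01 /andP[]; rewrite le_eqVlt => /predU1P[<- _|th0 th1].
  by rewrite mul0r cumulant0 mul0e.
rewrite -lee_pdivrMl//; apply: le_ereal_inf_tmp => _ [l /= /cumulant_constraint tl <-].
rewrite lee_pdivrMl//; apply: (@le_trans _ _ (\int[nu]_x psis (th * t * g x + th * l)%R)).
  apply: cumulant_le; apply: ideal_affineW tl => x h.
  by rewrite -mulrA -mulrDr; exact: slope_scale.
rewrite -ge0_integralZl_EFin ?(ltW th0)//; last exact: measurable_psis.
apply: ge0_le_integral => //.
- exact: measurable_psis.
- by apply: measurable_funeM; exact: measurable_psis.
- move=> x _; rewrite -mulrA -mulrDr; exact: star_convex.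
Qed.

Lemma cumulantN t : cumulant phi (fun x => - g x)%R nu Xi t = K (- t)%R.
Proof.
rewrite /cumulant.
have -> : (fun x => t * - g x)%R = (fun x => - t * g x)%R.
  by apply/funext => x; rewrite mulrN mulNr.
congr (ereal_inf (_ @` _)); apply/funext => l.
by apply: eq_integral => x _; rewrite mulrN mulNr.
Qed.

Hypothesis ig : nu.-integrable setT (EFin \o g).

Let integral_norm_affine t l : \int[nu]_x `|t * g x + l|%:E < +oo.
Proof.
have : nu.-integrable setT (fun x => (t * g x + l)%:E).
  under eq_fun do rewrite EFinD EFinM.
  by apply: integrableD => //; [exact: integrableZl|exact: finite_measure_integrable_cst].
by move=> /integrableP[].
Qed.

Let psis_homo (y z : R) : (0 <= y)%R -> (y <= z)%R -> psis y <= psis z.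
Proof. exact: star_convex_homo. Qed.

Let psis_neg (y : R) : (0 <= y)%R -> psis (- y)%R <= y%:E.
Proof.
by move=> y0; have := @conjugate_shift1_le _ _ hphi (- y)%R; rewrite opprK oppr_le0; exact.
Qed.

Let psis_max0 (y z : R) : (y <= z)%R -> psis (Num.max y 0)%R <= psis z.
Proof.
move=> yz; have [y0|y0] := leP y 0%R; first by rewrite psis0.
exact: psis_homo (ltW y0) yz.
Qed.

(* At most one of the two summands is nonzero. *)
Let psis_split (th h : R) : (0 <= th)%R ->
  psis (th * h)%R <= psis (th * Num.max h 0)%R + psis (- (th * Num.max (- h) 0))%R.
Proof.
move=> th0; have [h0|h0] := leP h 0%R.
  rewrite mulr0 psis0 add0e; have [|] := leP (- h)%R 0%R; last by rewrite mulrN opprK.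
  rewrite oppr_le0 => h0'; have -> : h = 0%R by apply/eqP; rewrite eq_le h0.
  by rewrite mulr0 oppr0.
by rewrite leeDl.
Qed.

(** With [l = th * n], the negative part of [g + n] costs at most [th] times its integral, since
    psi^*(- y) is at most [y]; [n] makes this integral at most [e / 2]. The positive part costs
    o(th), provided that its integral is finite and the constraint holds for some [th]. Securing
    these two points from [l0], which may lie below [t0 * n], is the work done with [D], [s] and
    [y1]. *)
Lemma cumulant_small_right t0 : (forall x : R, (0 < x)%R -> 0 < psi x) ->
  (0 < t0)%R -> K t0 < +oo ->
  forall e : R, (0 < e)%R -> exists2 t : R, (0 < t)%R & K t <= (e * t)%:E.
Proof.
move=> psi_pos t00 /cumulant_lt[l0 Xl0 i0] e e0.
have sub := conjugate_sublinear (shift1_ge0 hphi) (shift1_0 hphi)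
  (@econvex_shift1 _ _ hphi) psi_pos.
have [||||||n hn] := @dominated_small_integral R _ T nu
    (fun n x => (Num.max (- (g x + n%:R)) 0)%:E) (fun x => `|g x|%:E) _ _ _ _ _ (e / 2)%R.
- move=> n; apply/measurable_EFinP; apply: measurable_maxr => //.
  by apply: measurableT_comp => //; exact: measurable_funD.
- by apply/measurable_EFinP; exact: measurableT_comp.
- move=> n x; rewrite !lee_fin le_max lexx orbT/= ge_max normr_ge0 andbT.
  by have := ler_norm (- g x); rewrite normrN; have := ler0n R n; lra.
- by have /integrableP[] := ig.
- move=> x e1 e10; have : \forall n \near \oo, (- g x < n%:R)%R by exact: nbhs_infty_gtr.
  apply: filterS => n gn; rewrite lee_fin; have /max_idPr -> : (- (g x + n%:R) <= 0)%R by lra.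
  exact: ltW.
- by rewrite divr_gt0.
(* The gap between the desired multiplier [t0 * n] and the available [l0]. *)
pose D := (t0 * n%:R - l0)%R.
have [b b0 [bc hb]] := sub _ ltr01.
(* Chosen so that both [s <= 1 / 2] and [s * |D| <= b / 2], which together give [|y1| <= b]. *)
pose s := (b / (2 * b + 2 * `|D|))%R.
have s0 : (0 < s)%R by rewrite divr_gt0// ltr_wpDr// ?mulr_gt0// mulr_ge0.
have s12 : (s <= 1 / 2)%R.
  by rewrite ler_pdivrMr; [have := normr_ge0 D; lra|rewrite ltr_wpDr// ?mulr_gt0// mulr_ge0].
have sD : (s * `|D| <= b / 2)%R.
  rewrite /s mulrAC ler_pdivrMr; last by rewrite ltr_wpDr// ?mulr_gt0// mulr_ge0.
  by have := normr_ge0 D; nra.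
have bc' : b%:E <= c.
  apply: le_trans bc _; rewrite invr1 mul1e.
  by apply: le_trans (shift1_le_slope hphi ler01) _; rewrite mule1.
(* Defined so that [s * t0 * (g + n)] is the convex combination, with weights [s] and [1 - s], of
   [t0 * g + l0] and the constant [y1]. Since psi^*(y1) is finite and [y1 <= b <= c], both
   finiteness and the constraint are inherited from [t0]. *)
pose y1 := (s * D / (1 - s))%R.
have s1 : (0 < 1 - s)%R by lra.
have y1b : (`|y1| <= b)%R.
  rewrite /y1 normrM normfV (gtr0_norm s1) ler_pdivrMr// normrM (gtr0_norm s0).
  by apply: (le_trans sD); nra.
have psiy1 : psis y1 <= b%:E.
  have [y10|y10] := leP 0%R y1.
    have y1b' : (y1 <= b)%R by move: y1b; rewrite ger0_norm.
    by apply: (le_trans (hb _ _)); rewrite ?mul1r ?lee_fin ?y10.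
  rewrite -[y1]opprK; apply: (le_trans (psis_neg _)); first by rewrite oppr_ge0 ltW.
  by move: y1b; rewrite ltr0_norm.
have decomp x : (s * t0 * g x + s * t0 * n%:R = s * (t0 * g x + l0) + (1 - s) * y1)%R.
  by rewrite /y1 /D; field; rewrite gt_eqF.
have st0 : (0 < s * t0)%R by rewrite mulr_gt0.
have Xth : Xi [set x | c < (s * t0 * g x + s * t0 * n%:R)%:E].
  apply: ideal_affineW Xl0 => x; rewrite decomp.
  have := bc'; case: c => [r| |]; rewrite ?leey// !lee_fin => br hr.
  have : (y1 <= r)%R by apply: le_trans br; apply: le_trans y1b; exact: ler_norm.
  by nra.
have ith : \int[nu]_x psis (s * t0 * Num.max (g x + n%:R) 0)%R < +oo.
  apply: (@le_lt_trans _ _ (\int[nu]_x (psis (t0 * g x + l0)%R + b%:E))).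
    apply: ge0_le_integral => //.
    - apply: measurable_psis; apply: measurable_funM => //.
      by apply: measurable_maxr => //; exact: measurable_funD.
    - by apply: emeasurable_funD => //; exact: measurable_psis.
    move=> x _; apply: (@le_trans _ _ (psis (s * t0 * g x + s * t0 * n%:R)%R)).
      rewrite maxr_pMr ?(ltW st0)// mulr0 mulrDr; exact: psis_max0.
    rewrite decomp; apply: (le_trans (psis_cvx _ _ _)); first by rewrite ltW//=; lra.
    apply: leeD.
      by rewrite gee_pMl// lee_fin; lra.
    apply: le_trans psiy1; rewrite gee_pMl//; rewrite lee_fin; lra.
  rewrite ge0_integralD//; last 2 first.
  - exact: measurable_psis.
  - by move=> x _; rewrite lee_fin ltW.
  by rewrite integral_probability_cst lte_add_pinfty// ltry.
have [| | | | | | | | | |th /andP[th0 th1] ith'] := @sublinear_small_integral R _ T nu psis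
   (fun x => Num.max (g x + n%:R) 0)%R (s * t0)%R _ _ _ _ _ _ _ _ _ (e / 2)%R => //.
- exact: measurable_conjugate.
- by move=> e1 e10; have [b1 b10 [_ hb1]] := sub _ e10; exists b1.
- by apply: measurable_maxr => //; exact: measurable_funD.
- by move=> x; rewrite le_max lexx orbT.
- by rewrite divr_gt0.
exists th => //; apply: (le_trans (@cumulant_le th (th * n%:R) _)).
  apply: ideal_affineW Xth => x h.
  have -> : (th * g x + th * n%:R = (th / (s * t0)) * (s * t0 * g x + s * t0 * n%:R))%R.
    by field; rewrite !gt_eqF.
  by apply: slope_scale => //; rewrite divr_ge0 ?(ltW th0) ?(ltW st0)//= ler_pdivrMr// mul1r.
apply: (@le_trans _ _ (\int[nu]_x (psis (th * Num.max (g x + n%:R) 0)%R +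
     th%:E * (Num.max (- (g x + n%:R)) 0)%:E))).
  apply: ge0_le_integral => //.
  - exact: measurable_psis.
  - apply: emeasurable_funD.
      apply: measurable_psis; apply: measurable_funM => //.
      by apply: measurable_maxr => //; exact: measurable_funD.
    apply: measurable_funeM; apply/measurable_EFinP; apply: measurable_maxr => //.
    by apply: measurableT_comp => //; exact: measurable_funD.
  move=> x _; rewrite -mulrDr; apply: (le_trans (psis_split _ (ltW th0))).
  apply: leeD => //; rewrite -EFinM; apply: psis_neg.
  by rewrite mulr_ge0 ?(ltW th0)// le_max lexx orbT.
have mneg : measurable_fun setT (fun x => (Num.max (- (g x + n%:R)) 0)%:E).
  apply/measurable_EFinP; apply: measurable_maxr => //.
  by apply: measurableT_comp => //; exact: measurable_funD.
rewrite ge0_integralD//; last 3 first.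
- apply: measurable_psis; apply: measurable_funM => //.
  by apply: measurable_maxr => //; exact: measurable_funD.
- by move=> x _; rewrite -EFinM lee_fin mulr_ge0 ?(ltW th0)// le_max lexx orbT.
- exact: measurable_funeM.
rewrite ge0_integralZl_EFin ?(ltW th0)//; last by move=> x _; rewrite lee_fin le_max lexx orbT.
have -> : (e * th)%:E = (e / 2 * th)%:E + th%:E * (e / 2)%:E.
  by rewrite -EFinM -EFinD; congr EFin; field.
by apply: leeD => //; rewrite lee_pmul2l.
Qed.

(** Now [l] is lowered, which only relaxes the constraint. The negative part of [g + L] costs o(th)
    by the hypothesis on [psi (- x)]. The positive part is dominated by psi^*(t0 * g + l0), so its
    integral at [t0] tends to 0 as [n] grows; convexity then transports the bound from [t0] to
    [th]. *)
Lemma cumulant_small_left t0 : (forall x : R, (0 < x)%R -> 0 < psi (- x)%R) ->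
  (0 < t0)%R -> K t0 < +oo ->
  forall e : R, (0 < e)%R -> exists2 t : R, (0 < t)%R & K t <= (e * t)%:E.
Proof.
move=> psi_pos t00 /cumulant_lt[l0 Xl0 i0] e e0.
have sub (e1 : R) : (0 < e1)%R -> exists2 b : R, (0 < b)%R &
    forall y : R, (0 <= y <= b)%R -> psis (- y)%R <= (e1 * y)%:E.
  move=> e10; have [b b0 [_ hb]] := conjugate_sublinear (shift1_reflect_ge0 hphi)
    (shift1_reflect0 hphi) (@econvex_shift1_reflect _ _ hphi) psi_pos e10.
  by exists b => // y /hb; rewrite conjugate_reflect.
have mpos n : measurable_fun setT (fun x => psis (Num.max (t0 * g x + (l0 - t0 * n)) 0)%R).
  by apply: measurable_psis; exact: measurable_maxr.
(* The target [e / 2 * t0] compensates the factor [th / t0] that convexity produces. *)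
have [|||||n hn] := @dominated_small_integral R _ T nu
    (fun n x => psis (Num.max (t0 * g x + (l0 - t0 * n%:R)) 0)%R)
    (fun x => psis (t0 * g x + l0)%R) _ _ _ i0 _ (e / 2 * t0)%R.
- by move=> n; exact: mpos.
- exact: measurable_psis.
- move=> n x; rewrite psis_ge0; apply: psis_max0.
  by rewrite addrA gerBl mulr_ge0// ltW.
- move=> x e1 e10.
  have : \forall n \near \oo, (g x + l0 / t0 < n%:R)%R by exact: nbhs_infty_gtr.
  apply: filterS => n gn; have /max_idPr -> : (t0 * g x + (l0 - t0 * n%:R) <= 0)%R.
    have -> : (t0 * g x + (l0 - t0 * n%:R) = t0 * (g x + l0 / t0 - n%:R))%R.
      by field; rewrite gt_eqF.
    by rewrite mulr_ge0_le0 ?(ltW t00)// subr_le0 ltW.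
  by rewrite psis0 lee_fin ltW.
- by rewrite mulr_gt0// divr_gt0.
pose L := (l0 / t0 - n%:R)%R.
have LE x : (t0 * g x + (l0 - t0 * n%:R) = t0 * (g x + L))%R.
  by rewrite /L; field; rewrite gt_eqF.
have mneg : measurable_fun setT (fun x => Num.max (- (g x + L)) 0)%R.
  by apply: measurable_maxr => //; apply: measurableT_comp => //; exact: measurable_funD.
have [| | | | | | | | |th /andP[th0 th1] ith'] := @sublinear_small_integral R _ T nu
   (fun y => psis (- y)%R)
   (fun x => Num.max (- (g x + L)) 0)%R t0 _ _ _ _ sub _ _ _ _ (e / 2)%R => //.
- by rewrite oppr0.
- by move=> x y t t01; rewrite opprD -2!mulrN; exact: psis_cvx.
- apply: measurableT_comp; last exact: oppr_measurable.
  exact: measurable_conjugate.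
- by move=> x; rewrite le_max lexx orbT.
- apply: le_lt_trans (integral_norm_affine t0 (t0 * L)).
  apply: ge0_le_integral => //.
  + by apply: measurable_psis; apply: measurableT_comp => //; exact: measurable_funM.
  + by apply/measurable_EFinP; exact: measurableT_comp.
  move=> x _; apply: (le_trans (psis_neg _)).
    by rewrite mulr_ge0 ?(ltW t00)// le_max lexx orbT.
  rewrite lee_fin -mulrDr normrM gtr0_norm// ler_pM2l// ge_max normr_ge0 andbT.
  by rewrite -normrN ler_norm.
- by rewrite divr_gt0.
exists th => //; apply: (le_trans (@cumulant_le th (th * L) _)).
  apply: ideal_affineW Xl0 => x h.
  have -> : (th * g x + th * L = (th / t0) * (t0 * g x + l0 - t0 * n%:R))%R.
    by rewrite /L; field; rewrite gt_eqF.
  apply: slope_scale; first by rewrite divr_ge0 ?(ltW th0) ?(ltW t00)//= ler_pdivrMr// mul1r.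
  by apply: le_trans h; rewrite lee_fin gerBl mulr_ge0// ltW.
apply: (@le_trans _ _ (\int[nu]_x
    ((th / t0)%:E * psis (Num.max (t0 * g x + (l0 - t0 * n%:R)) 0)%R +
     psis (- (th * Num.max (- (g x + L)) 0))%R))).
  apply: ge0_le_integral => //.
  - exact: measurable_psis.
  - apply: emeasurable_funD; first exact: measurable_funeM.
    by apply: measurable_psis; apply: measurableT_comp => //; exact: measurable_funM.
  move=> x _; rewrite -mulrDr; apply: (le_trans (psis_split _ (ltW th0))).
  apply: leeD => //; rewrite LE.
  have -> : (th * Num.max (g x + L) 0 = th / t0 * Num.max (t0 * (g x + L)) 0)%R.
    have -> : Num.max (t0 * (g x + L))%R 0%R = (t0 * Num.max (g x + L) 0)%R.
      by rewrite maxr_pMr ?(ltW t00)// mulr0.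
    by rewrite mulrA divfK// gt_eqF.
  apply: star_convex => //.
  by rewrite divr_ge0 ?(ltW th0) ?(ltW t00)//= ler_pdivrMr// mul1r.
have tht0 : (0 <= th / t0)%R by rewrite divr_ge0 ?(ltW th0) ?(ltW t00).
rewrite ge0_integralD//; last 3 first.
- by move=> x _; rewrite mule_ge0.
- exact: measurable_funeM.
- by apply: measurable_psis; apply: measurableT_comp => //; exact: measurable_funM.
rewrite ge0_integralZl_EFin//.
have -> : (e * th)%:E = (th / t0)%:E * (e / 2 * t0)%:E + (e / 2 * th)%:E.
  by rewrite -EFinM -EFinD; congr EFin; field; rewrite gt_eqF.
by apply: leeD => //; rewrite lee_wpmul2l.
Qed.

Lemma cumulant_small t0 : ~ ([set x | phi x = 0])° 1%R -> (0 < t0)%R -> K t0 < +oo ->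
  forall e : R, (0 < e)%R -> exists2 t : R, (0 < t)%R & K t <= (e * t)%:E.
Proof.
move=> /(shift1_dichotomy hphi)[]; [exact: cumulant_small_right|exact: cumulant_small_left].
Qed.

End cumulant_theory.

(** * The Fenchel-Young inequality for divergences *)

Section fenchel_young_divergence.
Context d (T : measurableType d) (R : realType).
Variables (phi : R -> \bar R) (hphi : divergence_generator phi).
Local Notation psis := (conjugate (shift1 phi)).
Local Notation c := (slope_pinfty phi).

(* The inequality [(y - 1) * h <= phi y + psis h] with the negative terms moved to
   the other side, so that both sides can be integrated without subtraction. *)
Lemma young_posneg (y h : R) :
  (Num.max h 0 * y + Num.max (- h) 0)%:E <=
  phi y + psis h + (Num.max h 0)%:E + (Num.max (- h) 0 * y)%:E.
Proof.
have := fenchel_young (shift1_ge0 hphi) (shift1_0 hphi) (y - 1)%R h.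
rewrite /shift1 subrK => yh.
rewrite -addeA -EFinD.
have -> : (Num.max h 0 * y + Num.max (- h) 0 =
    (y - 1) * h + (Num.max h 0 + Num.max (- h) 0 * y))%R.
  have [h0|/ltW h0] := leP h 0%R.
    by have /max_idPl -> : (0 <= - h)%R; [rewrite oppr_ge0|ring].
  by have /max_idPr -> : (- h <= 0)%R; [rewrite oppr_le0|ring].
by rewrite [leLHS]EFinD; exact: (leeD yh (lexx _)).
Qed.

(** This one-sided form comes without the negative part of [h] on the right, so it gives the
    finiteness of the integral of the positive part under [P] before anything is known about the
    negative part. *)
Lemma young_pos (y h : R) :
  (Num.max h 0 * y)%:E <= phi y + psis h + (Num.max h 0)%:E.
Proof.
have phi0 := dg_ge0 hphi y.
have psis0 : 0 <= psis h by apply: conjugate_ge0; exact: (shift1_0 hphi).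
have := young_posneg y h; have [h0|h0] := leP h 0%R.
  by rewrite mul0r => _; rewrite !adde_ge0.
have /max_idPr -> : (- h <= 0)%R by rewrite oppr_le0 ltW.
by rewrite mul0r addr0 adde0.
Qed.

Variables (nu P : probability T R) (h : T -> R) (mh : measurable_fun setT h).
Hypothesis hP : P [set x | c < (h x)%:E] = 0.
Local Notation D := (phi_divergence phi (charge_of_finite_measure P) nu).

Let psis_ge0 y : 0 <= psis y.
Proof. apply: conjugate_ge0; exact: (shift1_0 hphi). Qed.

Let mpsis : measurable_fun setT (fun x => psis (h x)).
Proof. by apply: measurableT_comp mh; exact: measurable_conjugate. Qed.

Let hpos x := (Num.max (h x) 0)%:E.
Let hneg x := (Num.max (- h x) 0)%:E.

Let mhpos : measurable_fun setT hpos.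
Proof. by apply/measurable_EFinP; exact: measurable_maxr. Qed.

Let mhneg : measurable_fun setT hneg.
Proof.
by apply/measurable_EFinP; apply: measurable_maxr => //; exact: measurableT_comp.
Qed.

Let hpos0 x : 0 <= hpos x. Proof. by rewrite lee_fin le_max lexx orbT. Qed.
Let hneg0 x : 0 <= hneg x. Proof. by rewrite lee_fin le_max lexx orbT. Qed.

(** On the singular part of [P] no density is available; the constraint [h <= c], valid [P]-almost
    everywhere, bounds its contribution by exactly the singular term of the divergence. *)
Let singular_bound N : measurable N -> \int[P]_(x in N) hpos x <= P N * c.
Proof.
move=> mN; have mhposN := measurable_funTS mhpos : measurable_fun N hpos.
have [PN0|PN0] := eqVneq (P N) 0.
  by rewrite null_set_integral// PN0 mul0e.
have PN : 0 < P N by rewrite lt0e PN0/=.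
move: hP (slope_pinfty_ge0 hphi); case: c => [r Pr r0|_ _|//]; last first.
  by rewrite gt0_muley ?leey.
rewrite muleC -integral_cst//; apply: ae_ge0_le_integral => //.
exists [set x | r%:E < (h x)%:E]; split => //.
  rewrite -[X in measurable X]setTI; apply: emeasurable_fun_o_infty => //.
  exact/measurable_EFinP.
move=> x /= /not_implyP[_ /negP]; rewrite -ltNge /hpos lte_fin lt_max => /orP[//|].
by rewrite ltNge -lee_fin r0.
Qed.

(** The pointwise inequalities are integrated against [nu] at the density [f] of the absolutely
    continuous part, and [singular_bound] handles the rest of [P]. The second conjunct is the
    inequality between means, rearranged to be free of subtraction. *)
Lemma divergence_young :
  \int[P]_x hpos x <= D + \int[nu]_x psis (h x) + \int[nu]_x hpos x /\
  \int[P]_x hpos x + \int[nu]_x hneg x <=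
  D + \int[nu]_x psis (h x) + \int[nu]_x hpos x + \int[P]_x hneg x.
Proof.
have [N [f [mN nuN0 mf f0 [Pac _ ->]]]] := phi_divergenceE P nu hphi.
have mNC : measurable (~` N) by exact: measurableC.
have mphif : measurable_fun setT (fun x => phi (f x)).
  by apply: measurableT_comp mf; exact: measurable_generator.
have mfE : measurable_fun setT (fun x => (f x)%:E) by exact/measurable_EFinP.
have fE0 x : 0 <= (f x)%:E by rewrite lee_fin.
have phif0 x : 0 <= phi (f x) by exact: dg_ge0.
have splitN (u : T -> \bar R) : measurable_fun setT u -> (forall x, 0 <= u x) ->
    \int[P]_x u x = \int[P]_(x in N) u x + \int[nu]_x (u x * (f x)%:E).
  move=> mu u0; rewrite -Pac// -ge0_integral_setU ?setUv//; exact/disj_setPCl.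
have mposf : measurable_fun setT (fun x => hpos x * (f x)%:E) by exact: emeasurable_funM.
have mnegf : measurable_fun setT (fun x => hneg x * (f x)%:E) by exact: emeasurable_funM.
have posf0 x : 0 <= hpos x * (f x)%:E by exact: mule_ge0.
have negf0 x : 0 <= hneg x * (f x)%:E by exact: mule_ge0.
have I1 : \int[nu]_x (hpos x * (f x)%:E) <=
    \int[nu]_x phi (f x) + \int[nu]_x psis (h x) + \int[nu]_x hpos x.
  rewrite -ge0_integralD// -ge0_integralD//; last 2 first.
  - by move=> x _; exact: adde_ge0.
  - exact: emeasurable_funD.
  apply: ge0_le_integral => //.
    by do 2 apply: emeasurable_funD => //.
  by move=> x _; rewrite -EFinM; exact: young_pos.
have I2 : \int[nu]_x (hpos x * (f x)%:E) + \int[nu]_x hneg x <=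
    \int[nu]_x phi (f x) + \int[nu]_x psis (h x) + \int[nu]_x hpos x +
    \int[nu]_x (hneg x * (f x)%:E).
  rewrite -!ge0_integralD//; last 4 first.
  - by move=> x _; rewrite !adde_ge0.
  - by do 2 apply: emeasurable_funD => //.
  - by move=> x _; exact: adde_ge0.
  - exact: emeasurable_funD.
  apply: ge0_le_integral => //.
  - by move=> x _; exact: adde_ge0.
  - exact: emeasurable_funD.
  - by do 3 apply: emeasurable_funD => //.
  by move=> x _; rewrite -!EFinM -EFinD; exact: young_posneg.
have IN := singular_bound mN.
rewrite (splitN hpos)// (splitN hneg)//.
set A := \int[nu]_x phi (f x); set B := \int[nu]_x psis (h x).
set C := \int[nu]_x hpos x; split.
  have -> : A + P N * c + B + C = P N * c + (A + B + C).
    by rewrite (addeC A) !addeA.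
  exact: leeD.
set J := \int[nu]_x (hneg x * _); set M := \int[P]_(x in N) hneg x.
have -> : A + P N * c + B + C + (M + J) = P N * c + (A + B + C + J) + M.
  by rewrite (addeC M) (addeC A) !addeA.
apply: (@le_trans _ _ (P N * c + (A + B + C + J))).
  by rewrite -addeA; exact: leeD.
by rewrite leeDl// integral_ge0.
Qed.

End fenchel_young_divergence.

(** * Continuity of the mean under vanishing divergence *)

Section divergence_continuity.
Context d (T : measurableType d) (R : realType).
Variables (phi : R -> \bar R) (hphi : divergence_generator phi).
Variables (Xi : set (set T)) (hXi : sigma_ideal Xi).
Variable (nu : probability T R).
Local Notation psis := (conjugate (shift1 phi)).
Local Notation D P := (phi_divergence phi (charge_of_finite_measure P) nu).
Local Notation K g := (cumulant phi g nu Xi).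

(** Only the upper half of continuity; the lower half is the same statement for [- g]. The constant
    [l] disappears from the comparison of means because [P] and [nu] have the same mass. *)
Lemma divergence_upper_continuity (g : T -> R) :
  measurable_fun setT g -> nu.-integrable setT (EFin \o g) ->
  (forall e : R, (0 < e)%R -> exists2 t : R, (0 < t)%R & K g t <= (e * t)%:E) ->
  forall e : R, (0 < e)%R -> exists2 b : R, (0 < b)%R &
  forall P : probability T R, (forall A, Xi A -> P A = 0) -> D P <= b%:E ->
    \int[P]_x (Num.max (g x) 0)%:E < +oo /\
    (P.-integrable setT (EFin \o g) ->
     \int[P]_x (g x)%:E <= \int[nu]_x (g x)%:E + e%:E).
Proof.
move=> mg ig Ksmall e e0.
(* Starting from [e / 4] leaves room for the strict inequality that extracts [l] from the infimum;
   the divergence then receives the other half of the budget [e * t]. *)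
have e4 : (0 < e / 4)%R by rewrite divr_gt0.
have [t t0 Kt] := Ksmall _ e4.
have Kt2 : K g t < (e / 2 * t)%:E.
  by apply: (le_lt_trans Kt); rewrite lte_fin ltr_pM2r//; lra.
have [l Xl il] := cumulant_lt hphi hXi mg Kt2.
exists (e / 2 * t)%R; first by rewrite mulr_gt0// divr_gt0.
move=> P PXi DP.
pose h x := (t * g x + l)%R.
have mh : measurable_fun setT h by apply: measurable_funD => //; exact: measurable_funM.
have integrable_affine (m : probability T R) : m.-integrable setT (EFin \o g) ->
    m.-integrable setT (EFin \o h).
  move=> mi; rewrite /comp /h; under eq_fun do rewrite EFinD EFinM.
  by apply: integrableD => //; [exact: integrableZl|exact: finite_measure_integrable_cst].
have posE (m : probability T R) :
    \int[m]_x (Num.max (h x) 0)%:E = \int[m]_x ((EFin \o h)^\+ x).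
  by apply: eq_integral => x _; rewrite funeposE /= EFin_max.
have negE (m : probability T R) :
    \int[m]_x (Num.max (- h x) 0)%:E = \int[m]_x ((EFin \o h)^\- x).
  by apply: eq_integral => x _; rewrite funenegE /= EFin_max.
have integral_affine (m : probability T R) : m.-integrable setT (EFin \o g) ->
    \int[m]_x (h x)%:E = t%:E * \int[m]_x (g x)%:E + l%:E.
  move=> mi; rewrite /h; under eq_integral do rewrite EFinD EFinM.
  rewrite integralD//; last 2 first.
  - exact: integrableZl.
  - exact: finite_measure_integrable_cst.
  by rewrite integralZl// integral_probability_cst.
have [young1 young2] := divergence_young hphi nu mh (PXi _ Xl).
have nuh := integrable_affine nu ig.
have Dbound : D P + \int[nu]_x psis (h x) <= (e * t)%:E.
  have -> : (e * t)%:E = (e / 2 * t)%:E + (e / 2 * t)%:E.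
    by rewrite -EFinD; congr EFin; field.
  by apply: leeD => //; exact: ltW.
have Ppos : \int[P]_x (Num.max (h x) 0)%:E < +oo.
  apply: (le_lt_trans young1); rewrite lte_add_pinfty//.
    by apply: (le_lt_trans Dbound); rewrite ltry.
  by rewrite posE; exact: integral_funepos_lt_pinfty.
split.
  (* Solving [h = t * g + l] for [g] bounds its positive part by that of [h] divided by [t], plus
     [|l| / t]. *)
  apply: (@le_lt_trans _ _ (\int[P]_x (t^-1%:E * (Num.max (h x) 0)%:E + (`|l| / t)%:E))).
    apply: ge0_le_integral => //.
    - by move=> x _; rewrite lee_fin le_max lexx orbT.
    - by apply/measurable_EFinP; exact: measurable_maxr.
    - apply: emeasurable_funD => //; apply: measurable_funeM; apply/measurable_EFinP.
      exact: measurable_maxr.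
    move=> x _; rewrite -EFinM -EFinD lee_fin mulrC -mulrDl ler_pdivlMr//.
    have hm : (t * g x + l <= Num.max (h x) 0)%R by rewrite le_max lexx.
    have m0 : (0 <= Num.max (h x) 0)%R by rewrite le_max lexx orbT.
    have := ler_norm (- l); rewrite normrN => ll; have := normr_ge0 l.
    by rewrite maxr_pMl ?(ltW t0)// mul0r ge_max => l00; apply/andP; split; lra.
  rewrite ge0_integralD//; last 3 first.
  - by move=> x _; rewrite -EFinM lee_fin mulr_ge0 ?invr_ge0 ?(ltW t0)// le_max lexx orbT.
  - apply: measurable_funeM; apply/measurable_EFinP; exact: measurable_maxr.
  - by move=> x _; rewrite lee_fin divr_ge0// ltW.
  rewrite ge0_integralZl_EFin//; last 3 first.
  - by move=> x _; rewrite lee_fin le_max lexx orbT.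
  - by apply/measurable_EFinP; exact: measurable_maxr.
  - by rewrite invr_ge0 ltW.
  rewrite integral_probability_cst lte_add_pinfty ?ltry// lte_mul_pinfty//.
  by rewrite lee_fin invr_ge0 ltW.
move=> Pg; have Ph := integrable_affine P Pg.
have main : \int[P]_x (h x)%:E <= (e * t)%:E + \int[nu]_x (h x)%:E.
  have Ppfin := integrable_pos_fin_num measurableT Ph.
  have Pnfin := integrable_neg_fin_num measurableT Ph.
  have npfin := integrable_pos_fin_num measurableT nuh.
  have nnfin := integrable_neg_fin_num measurableT nuh.
  rewrite [X in X <= _]integralE [X in _ <= _ + X]integralE.
  have := le_trans young2 (leeD (leeD Dbound (lexx _)) (lexx _)).
  rewrite !posE !negE -(fineK Ppfin) -(fineK Pnfin) -(fineK npfin) -(fineK nnfin).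
  by rewrite -?EFinN -!EFinD !lee_fin; lra.
have gfin : \int[P]_x (g x)%:E \is a fin_num by exact: integrable_fin_num.
have gnufin : \int[nu]_x (g x)%:E \is a fin_num by exact: integrable_fin_num.
move: main; rewrite !integral_affine//.
rewrite -(fineK gfin) -(fineK gnufin) -!EFinM -!EFinD !lee_fin => main.
by rewrite -(ler_pM2l t0); lra.
Qed.

End divergence_continuity.

(** * Perturbations at small divergence *)

Section mixture.
Context d (T : measurableType d) (R : realType).
Implicit Types (nu P Q : probability T R) (e : R).

Lemma probability_of_measure (m : {measure set T -> \bar R}) nu : m setT = 1 ->
  exists Q : probability T R, forall A, Q A = m A.
Proof.
move=> m1; exists (mnormalize m nu) => A.
by rewrite /= /mnormalize m1 onee_eq0/= invr1 mule1.
Qed.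

Lemma probability_of_density nu (p : T -> R) :
  measurable_fun setT p -> (forall x, 0 <= p x)%R -> \int[nu]_x (p x)%:E = 1 ->
  exists P : probability T R,
    forall A, measurable A -> P A = \int[nu]_(x in A) (p x)%:E.
Proof.
move=> mp p0 p1.
have ip : nu.-integrable setT (EFin \o p).
  apply/integrableP; split => /=; first exact/measurable_EFinP.
  by under eq_integral do rewrite ger0_norm//; rewrite p1 ltry.
have pos E : 0 <= induced_charge ip E.
  by apply: integral_ge0 => x _; rewrite lee_fin.
have [P PE] := probability_of_measure (m := measure_of_charge _ pos) nu p1.
by exists P.
Qed.

Lemma measure_setIC_null P (A N : set T) : measurable A -> measurable N ->
  P N = 0 -> P (A `&` ~` N) = P A.
Proof.
move=> mA mN PN0; rewrite [RHS](measureDI P mA mN) setDE.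
rewrite [X in _ = _ + X](_ : _ = 0) ?adde0//.
apply/eqP; rewrite eq_le measure_ge0 andbT -PN0.
by apply: le_measure; rewrite ?inE//; exact: measurableI.
Qed.

Definition is_mixture e nu P Q :=
  forall A, measurable A -> Q A = (1 - e)%:E * nu A + e%:E * P A.

Lemma mixture_exists e nu P : (0 <= e <= 1)%R -> exists Q, is_mixture e nu P Q /\
  forall u : T -> \bar R, measurable_fun setT u -> (forall x, 0 <= u x) ->
  \int[Q]_x u x = (1 - e)%:E * \int[nu]_x u x + e%:E * \int[P]_x u x.
Proof.
move=> /andP[e0 e1]; have e1' : (0 <= 1 - e)%R by rewrite subr_ge0.
pose m : {measure set T -> \bar R} :=
  measure_add (mscale (NngNum e1') nu) (mscale (NngNum e0) P).
have mE A : m A = (1 - e)%:E * nu A + e%:E * P A by exact: measure_addE.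
have m1 : m setT = 1.
  rewrite mE [X in _ * X + _](_ : _ = 1); last exact: probability_setT.
  rewrite [X in _ + _ * X](_ : _ = 1); last exact: probability_setT.
  by rewrite !mule1 -EFinD subrK.
have [Q QE] := probability_of_measure nu m1.
exists Q; split=> [A _|u mu u0]; first by rewrite QE mE.
rewrite (eq_measure_integral m); last by move=> A _ _; exact: QE.
by rewrite ge0_integral_measure_add// !ge0_integral_mscale.
Qed.

Lemma mixture_integral e nu P Q (g : T -> R) : (0 <= e <= 1)%R ->
  (forall u : T -> \bar R, measurable_fun setT u -> (forall x, 0 <= u x) ->
  \int[Q]_x u x = (1 - e)%:E * \int[nu]_x u x + e%:E * \int[P]_x u x) ->
  nu.-integrable setT (EFin \o g) -> P.-integrable setT (EFin \o g) ->
  Q.-integrable setT (EFin \o g) /\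
  \int[Q]_x (g x)%:E = (1 - e)%:E * \int[nu]_x (g x)%:E + e%:E * \int[P]_x (g x)%:E.
Proof.
move=> /andP[e0 e1] QE ig iP.
have mg := measurable_int _ ig; have mgp := measurable_funepos mg.
have mgn := measurable_funeneg mg.
have iQ : Q.-integrable setT (EFin \o g).
  apply/integrableP; split => //; rewrite QE//; last exact: measurableT_comp.
  have /integrableP[_ inu] := ig; have /integrableP[_ iPu] := iP.
  by rewrite lte_add_pinfty// lte_mul_pinfty// lee_fin// subr_ge0.
split => //.
rewrite integralE [in RHS]integralE [X in _ = _ + _ * X]integralE !QE//.
rewrite -(fineK (integrable_pos_fin_num measurableT ig)).
rewrite -(fineK (integrable_neg_fin_num measurableT ig)).
rewrite -(fineK (integrable_pos_fin_num measurableT iP)).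
rewrite -(fineK (integrable_neg_fin_num measurableT iP)).
rewrite -?EFinN -?EFinD -?EFinM -?EFinD -?EFinN -?EFinM -?EFinD; congr EFin; ring.
Qed.

Variables (phi : R -> \bar R) (hphi : divergence_generator phi).
Local Notation psi := (shift1 phi).
Local Notation c := (slope_pinfty phi).

(** Separates the cost of removing mass [e] from that of adding [q]: the point [q - e] lies between
    0 and one of [- e] and [q], and [psi] increases away from 0 on either side. *)
Lemma generator_subadditive (e q : R) : (0 <= e)%R -> (0 <= q)%R ->
  phi (1 - e + q)%R <= phi (1 - e)%R + psi q.
Proof.
move=> e0 q0; have [qe|/ltW eq] := leP q e.
  have -> : phi (1 - e + q)%R = psi (- (e - q))%R by rewrite /shift1; congr phi; ring.
  have -> : phi (1 - e)%R = psi (- e)%R by rewrite /shift1 addrC.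
  apply: (@le_trans _ _ (psi (- e)%R)); last by rewrite leeDl// (shift1_ge0 hphi).
  apply: (star_convex_homo (shift1_reflect_ge0 hphi) (shift1_reflect0 hphi)
    (@econvex_shift1_reflect _ _ hphi)); first by rewrite subr_ge0.
  by rewrite gerBl.
have -> : phi (1 - e + q)%R = psi (q - e)%R by rewrite /shift1; congr phi; ring.
apply: (@le_trans _ _ (psi q)); last by rewrite leeDr// (dg_ge0 hphi).
apply: (star_convex_homo (shift1_ge0 hphi) (shift1_0 hphi) (@econvex_shift1 _ _ hphi)).
  by rewrite subr_ge0.
by rewrite gerBl.
Qed.

Lemma phi_divergence_ge0 nu P :
  0 <= phi_divergence phi (charge_of_finite_measure P) nu.
Proof.
have [N [f [_ _ _ _ [_ _ ->]]]] := phi_divergenceE P nu hphi.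
rewrite adde_ge0 ?integral_ge0 ?mule_ge0 ?(slope_pinfty_ge0 hphi)// => x _.
exact: dg_ge0.
Qed.

(** The divergence is defined through the decomposition chosen for [Q]. Since [nu] ignores [N] and
    [e > 0], the same [N] also carries the singular part of [P], and the density of [Q] is almost
    everywhere [1 - e + e * p]. *)
Lemma mixture_divergence e nu P Q : (0 < e <= 1)%R -> is_mixture e nu P Q ->
  exists N (p : T -> R), [/\ measurable N, nu N = 0, measurable_fun setT p,
    (forall x, 0 <= p x)%R &
    (forall A, measurable A -> P (A `&` ~` N) = \int[nu]_(x in A) (p x)%:E) /\
    phi_divergence phi (charge_of_finite_measure Q) nu =
      \int[nu]_x phi (1 - e + e * p x)%R + e%:E * P N * c].
Proof.
move=> /andP[e0 e1] QE.
have [N [f [mN nuN0 mf f0 [_ Qac ->]]]] := phi_divergenceE Q nu hphi.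
have mNC : measurable (~` N) by exact: measurableC.
pose Pc : {finite_measure set T -> \bar R} := mrestr P mNC.
have nuNC A : measurable A -> nu (A `&` ~` N) = nu A.
  by move=> mA; exact: measure_setIC_null.
have Pcnu : Pc `<< nu.
  apply/null_content_dominatesP => A mA A0.
  have mAN : measurable (A `&` ~` N) by exact: measurableI.
  have : Q (A `&` ~` N) = 0.
    by rewrite Qac// null_set_integral//; apply/measurable_EFinP; exact: measurable_funTS.
  rewrite QE// nuNC// A0 mule0 add0e => /eqP; rewrite mule_eq0 eqe gt_eqF//= => /eqP.
  exact.
pose F := Radon_Nikodym_SigmaFinite.f Pc nu.
have F0 x : 0 <= F x by exact: Radon_Nikodym_SigmaFinite.f_ge0.
have Ffin x : F x \is a fin_num by exact: Radon_Nikodym_SigmaFinite.f_fin_num.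
have Fi : nu.-integrable setT F by exact: Radon_Nikodym_SigmaFinite.f_integrable.
have mF := measurable_int _ Fi.
have PcE A : measurable A -> P (A `&` ~` N) = \int[nu]_(x in A) F x.
  by move=> mA; rewrite -Radon_Nikodym_SigmaFinite.f_integral.
exists N, (fine \o F); split => //.
- exact: measurableT_comp.
- by move=> x; exact: fine_ge0.
split=> [A mA|]; first by under eq_integral do rewrite fineK//; exact: PcE.
have -> : Q N = e%:E * P N by rewrite QE// nuN0 mule0 add0e.
congr (_ + _).
have mphi := measurable_generator hphi.
have mp : measurable_fun setT (fun x => 1 - e + e * (fine \o F) x)%R.
  apply: measurable_funD => //; apply: measurable_funM => //.
  exact: measurableT_comp.
apply: ae_eq_integral => //; [exact: measurableT_comp|exact: measurableT_comp|].
have ae : ae_eq nu setT (fun x => (1 - e)%:E + e%:E * F x) (EFin \o f).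
  apply: integral_ae_eq => //.
  - by apply: integrableD => //; [exact: finite_measure_integrable_cst|exact: integrableZl].
  - exact/measurable_EFinP.
  move=> A _ mA; rewrite -Qac// QE; last exact: measurableI.
  rewrite nuNC// PcE// integralD//; last 2 first.
  - exact: finite_measure_integrable_cst.
  - by apply: integrableZl => //; exact: (integrableS measurableT).
  rewrite integral_cst// integralZl//; exact: (integrableS measurableT).
apply: filterS ae => x /(_ Logic.I) h _ /=; congr phi.
by move: h => /=; rewrite -{1}(fineK (Ffin x)) -EFinM -EFinD => -[].
Qed.

(** Beyond [phi (1 - e)], the density part of [P] costs at most [e * c] times its mass and the
    singular part exactly that; the two masses add up to 1. The bound is uniform in [P]. *)
Lemma mixture_divergence_le_slope e nu P Q : (0 < e <= 1)%R -> is_mixture e nu P Q ->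
  phi_divergence phi (charge_of_finite_measure Q) nu <= phi (1 - e)%R + e%:E * c.
Proof.
move=> /[dup] e01 /andP[e0 e1] /(mixture_divergence e01).
move=> [N [p [mN nuN0 mp p0 [PE ->]]]].
have mphi := measurable_generator hphi.
have mpE : measurable_fun setT (fun x => (p x)%:E) by exact/measurable_EFinP.
have mix0 x : (0 <= e * p x)%R by rewrite mulr_ge0 ?(ltW e0).
have := slope_pinfty_ge0 hphi; case E : c => [r| |//]; last first.
  rewrite [e%:E * +oo]gt0_muley// addey ?leey// gt_eqF//.
  by rewrite (lt_le_trans _ (dg_ge0 hphi _))// ltNyr.
move=> r0; have r0' : (0 <= r)%R by [].
have IN : \int[nu]_x phi (1 - e + e * p x)%R <=
    phi (1 - e)%R + (r * e)%:E * P (~` N).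
  have -> : P (~` N) = \int[nu]_x (p x)%:E by rewrite -PE// setTI.
  have phicst : \int[nu]_x (cst (phi (1 - e)%R) x) = phi (1 - e)%R.
    by rewrite integral_cst// [X in _ * X](_ : _ = 1) ?mule1//; exact: probability_setT.
  rewrite -[X in _ <= X + _]phicst -ge0_integralZl_EFin//; last 2 first.
  - by move=> x _; rewrite lee_fin.
  - by rewrite mulr_ge0// ltW.
  rewrite -ge0_integralD//; last 3 first.
  - by move=> x _; exact: dg_ge0.
  - by move=> x _; rewrite -EFinM lee_fin !mulr_ge0// ltW.
  - exact: measurable_funeM.
  apply: ge0_le_integral => //.
  - by move=> x _; exact: dg_ge0.
  - apply: measurableT_comp => //; apply: measurable_funD => //.
    exact: measurable_funM.
  - by apply: emeasurable_funD => //; exact: measurable_funeM.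
  move=> x _; apply: (le_trans (generator_subadditive (ltW e0) (mix0 x))).
  apply: leeD => //; apply: (le_trans (shift1_le_slope hphi (mix0 x))).
  by rewrite E -!EFinM mulrA.
have P1 : P (~` N) + P N = 1.
  rewrite -measureU//; [|exact: measurableC|by rewrite setICl].
  by rewrite setUC setUv; exact: probability_setT.
apply: (le_trans (leeD IN (lexx _))).
have PNCfin : P (~` N) \is a fin_num by apply: fin_num_measure; exact: measurableC.
have PNfin : P N \is a fin_num by exact: fin_num_measure.
rewrite -addeA leeD// -(fineK PNCfin) -(fineK PNfin) -!EFinM -EFinD lee_fin.
move: P1; rewrite -(fineK PNCfin) -(fineK PNfin) -EFinD => -[].
by move=> P1; rewrite -[leRHS]mulr1 -P1 le_eqVlt; apply/orP; left; apply/eqP; ring.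
Qed.

Lemma mixture_divergence_le_density e nu P Q (p : T -> R) : c = +oo ->
  (0 < e <= 1)%R -> is_mixture e nu P Q ->
  measurable_fun setT p -> (forall x, 0 <= p x)%R ->
  (forall A, measurable A -> P A = \int[nu]_(x in A) (p x)%:E) ->
  phi_divergence phi (charge_of_finite_measure Q) nu <=
  phi (1 - e)%R + \int[nu]_x psi (e * p x)%R.
Proof.
move=> coo /[dup] e01 /andP[e0 e1] /(mixture_divergence e01).
move=> [N [p1 [mN nuN0 mp1 p10 [PE ->]]]] mp p0 Pp.
have mphi := measurable_generator hphi.
have mpE : measurable_fun setT (fun x => (p x)%:E) by exact/measurable_EFinP.
have mp1E : measurable_fun setT (fun x => (p1 x)%:E) by exact/measurable_EFinP.
have PN0 : P N = 0.
  by rewrite Pp// null_set_integral//; exact: measurable_funTS.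
rewrite PN0 mule0 mul0e adde0.
have ae : ae_eq nu setT (EFin \o p) (EFin \o p1).
  apply: integral_ae_eq => //.
    apply/integrableP; split => //=; under eq_integral do rewrite ger0_norm//.
    by rewrite -Pp// (le_lt_trans (probability_le1 _ _))// ltry.
  by move=> A _ mA; rewrite -PE// -Pp// measure_setIC_null.
have mix0 x : (0 <= e * p x)%R by rewrite mulr_ge0 ?(ltW e0).
have mep : measurable_fun setT (fun x => e * p x)%R by exact: measurable_funM.
rewrite (_ : \int[nu]_x phi (1 - e + e * p1 x)%R = \int[nu]_x phi (1 - e + e * p x)%R).
  have phicst : \int[nu]_x (cst (phi (1 - e)%R) x) = phi (1 - e)%R.
    by rewrite integral_cst// [X in _ * X](_ : _ = 1) ?mule1//; exact: probability_setT.
  have mpsi : measurable_fun setT (fun x => psi (e * p x)%R).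
    by rewrite /shift1; apply: measurableT_comp => //; exact: measurable_funD.
  rewrite -[X in _ <= X + _]phicst -ge0_integralD//; last 2 first.
  - by move=> x _; exact: dg_ge0.
  - by move=> x _; exact: shift1_ge0.
  apply: ge0_le_integral => //.
  - by move=> x _; exact: dg_ge0.
  - by apply: measurableT_comp => //; exact: measurable_funD.
  - exact: emeasurable_funD.
  by move=> x _; exact: (generator_subadditive (ltW e0) (mix0 x)).
apply: ae_eq_integral => //.
- apply: measurableT_comp => //; apply: measurable_funD => //; exact: measurable_funM.
- by apply: measurableT_comp => //; exact: measurable_funD.
by apply: filterS ae => x /(_ Logic.I)[pE] _ /=; rewrite pE.
Qed.

End mixture.

(** * Tilted densities when the slope at infinity is infinite *)

Section optimal_tilt.
Context {R : realType}.
Variables (phi : R -> \bar R) (hphi : divergence_generator phi).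
Hypothesis slope_oo : slope_pinfty phi = +oo.
Local Notation psi := (shift1 phi).
Local Notation psis := (conjugate (shift1 phi)).

(* The largest deviation [x] whose cost [psi x] is paid for by its gain [x * y];
   its gain bounds the supremum defining [psis y]. *)
Definition max_tilt (y : R) : R := sup [set x : R | (0 <= x)%R /\ psi x <= (x * y)%:E].

(** Superlinearity gives some [x0] with [psi x0 > y * x0], and monotonicity of [psi x / x] keeps
    this strict inequality beyond [x0]. *)
Lemma has_sup_max_tilt y : has_sup [set x : R | (0 <= x)%R /\ psi x <= (x * y)%:E].
Proof.
split; first by exists 0%R; rewrite /= mul0r (shift1_0 hphi).
have [x0 x00 yx0] := shift1_superlinear hphi y slope_oo.
exists x0 => x /= [x_ge0 psix]; rewrite leNgt; apply/negP => /ltW x0x.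
have := star_convex_slope (shift1_0 hphi) (@econvex_shift1 _ _ hphi) x00 x0x.
move=> /le_trans /(_ psix); rewrite leNgt => /negP; apply.
have xx0 : (0 < x / x0)%R by rewrite divr_gt0// (lt_le_trans x00).
have -> : (x * y)%:E = (x / x0)%:E * (y * x0)%:E.
  by rewrite -EFinM; congr EFin; field; rewrite gt_eqF.
by rewrite lte_pmul2l.
Qed.

Lemma max_tilt_ge0 y : (0 <= max_tilt y)%R.
Proof.
apply: (sup_upper_bound (has_sup_max_tilt y)) => /=.
by rewrite mul0r (shift1_0 hphi).
Qed.

Lemma max_tilt_homo : {homo max_tilt : x y / (x <= y)%R}.
Proof.
move=> y z yz; apply: sup_le; [|exact: (has_sup_max_tilt y).1|exact: has_sup_max_tilt].
move=> x /= [x0 psix]; exists x; split => //=; split => //.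
by apply: le_trans psix _; rewrite lee_fin ler_wpM2l.
Qed.

(** With [th < 1], the point [th * max_tilt y] lies below a genuine element of the set, and the
    defining inequality passes from that element to smaller points by convexity. *)
Lemma shift1_max_tilt (th y : R) : (0 <= th < 1)%R ->
  psi (th * max_tilt y)%R <= (th * max_tilt y * y)%:E.
Proof.
move=> /andP[th0 th1].
have [X0|XN0] := eqVneq (max_tilt y) 0%R; first by rewrite X0 mulr0 (shift1_0 hphi) mul0r.
have X0 : (0 < max_tilt y)%R by rewrite lt_def XN0 max_tilt_ge0.
have : (th * max_tilt y < max_tilt y)%R by rewrite gtr_pMl.
move=> /(sup_gt (has_sup_max_tilt y).1)[x /= [x0 psix] thx].
have xp : (0 < x)%R by apply: le_lt_trans thx; rewrite mulr_ge0// ltW.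
rewrite -{1}(divfK (lt0r_neq0 xp) (th * max_tilt y)%R).
have s0 : (0 <= th * max_tilt y / x)%R by rewrite divr_ge0 ?mulr_ge0 ?(ltW X0).
apply: (le_trans (star_convex (shift1_0 hphi) (@econvex_shift1 _ _ hphi) _ _)).
  by rewrite s0/= ler_pdivrMr// mul1r ltW.
apply: (@le_trans _ _ ((th * max_tilt y / x)%:E * (x * y)%:E)).
  by rewrite lee_wpmul2l.
by rewrite -EFinM mulrA divfK// gt_eqF.
Qed.

Lemma conjugate_le_max_tilt y : (0 <= y)%R -> psis y <= (max_tilt y * y)%:E.
Proof.
move=> y0; apply: conjugate_le => x.
have Xy : (0 <= max_tilt y * y)%R by rewrite mulr_ge0// max_tilt_ge0.
have [x0|x0] := ltP x 0%R.
  apply: (@le_trans _ _ (x * y)%:E).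
    by rewrite geeDl// oppe_le0 (shift1_ge0 hphi).
  by rewrite lee_fin (le_trans _ Xy)// mulr_le0_ge0// ltW.
have [psix|/ltW psix] := leP (psi x) (x * y)%:E; last first.
  apply: (@le_trans _ _ 0); last by rewrite lee_fin.
  by rewrite sube_le0.
apply: (@le_trans _ _ (x * y)%:E).
  by rewrite geeDl// oppe_le0 (shift1_ge0 hphi).
by rewrite lee_fin ler_wpM2r//; apply: (sup_upper_bound (has_sup_max_tilt y)).
Qed.

Context d (T : measurableType d) (nu : probability T R).
Variables (g : T -> R) (ig : nu.-integrable setT (EFin \o g)).

Let mg : measurable_fun setT g.
Proof. by apply/measurable_EFinP; exact: measurable_int ig. Qed.

(** [w] is [max_tilt (t * g)] cut off to [M <= g <= k]. The upper cut makes [w] and [g] bounded on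
    the support, so the normalized density will integrate [g]; the lower cut forces a mean of at
    least [M]. *)
Lemma tilting_density (t M : R) : (0 < t)%R -> (0 < M)%R ->
  \int[nu]_x psis (t * g x)%R = +oo ->
  exists (w : T -> R) (k : R), [/\ measurable_fun setT w, (forall x, 0 <= w x <= k)%R,
    (forall x, w x != 0 -> M <= g x <= k)%R,
    4%:E <= \int[nu]_x (w x * g x)%:E &
    forall x th, (0 <= th < 1)%R ->
      psi (th * w x)%R <= (th * w x * (t * g x))%:E].
Proof.
move=> t0 M0 ioo.
pose X x := max_tilt (t * g x).
have mX : measurable_fun setT X.
  apply: (measurableT_comp (nondecreasing_measurable measurableT max_tilt_homo)).
  exact: measurable_funM.
have X0 x : (0 <= X x)%R by exact: max_tilt_ge0.
pose A k := [set x | (M <= g x <= k%:R)%R].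
have mA k : measurable (A k).
  have -> : A k = g @^-1` `[M, k%:R].
    by apply/seteqP; split=> x /=; rewrite in_itv.
  by rewrite -[_ @^-1` _]setTI; exact: mg.
pose f x := (X x * g x)%:E.
have mf : measurable_fun setT f by apply/measurable_EFinP; exact: measurable_funM.
have f0 k x : A k x -> 0 <= f x.
  by move=> /andP[Mg _]; rewrite lee_fin mulr_ge0// (le_trans _ Mg)// ltW.
(* Otherwise monotone convergence bounds the integral of [f] over [M <= g] by 4, which would make
   the integral of psi^*(t * g) finite. *)
have [k hk] : exists k, 4%:E <= \int[nu]_(x in A k) f x.
  apply: contrapT => /forallNP small.
  have ndA : nondecreasing_seq A.
    move=> n m nm; rewrite subsetEset => x /= /andP[Mg gn].
    by apply/andP; split => //; rewrite (le_trans gn)// ler_nat.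
  have mfA i : measurable_fun (A i) f by exact: measurable_funTS.
  have cvA := ge0_nondecreasing_set_cvg_integral (mu := nu) ndA mA mfA f0.
  have UA : \bigcup_i A i = [set x | (M <= g x)%R].
    apply/seteqP; split=> [x [i _ /andP[]]//|x /= Mg].
    exists (Num.truncn (g x)).+1 => //=.
    by apply/andP; split => //; rewrite ltW// truncnS_gt.
  have mU : measurable [set x | (M <= g x)%R] by rewrite -UA; exact: bigcupT_measurable.
  have le4 : \int[nu]_(x in [set x | (M <= g x)%R]) f x <= 4%:E.
    rewrite -UA -(cvg_lim _ cvA)//; apply: lime_le; first by apply/cvgP: cvA.
    by apply: nearW => i; rewrite leNgt; apply/negP => /ltW; exact: small.
  suff : \int[nu]_x psis (t * g x)%R < +oo by rewrite ioo.
  pose U := [set x | (M <= g x)%R].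
  have psistM : psis (t * M)%R <= (max_tilt (t * M) * (t * M))%:E.
    by apply: conjugate_le_max_tilt; rewrite mulr_ge0// ltW.
  set b := (max_tilt (t * M) * (t * M))%R in psistM.
  have b0 : (0 <= b)%R by rewrite mulr_ge0 ?max_tilt_ge0 ?mulr_ge0 ?(ltW t0) ?(ltW M0).
  have psis_ge0 y : 0 <= psis y by apply: conjugate_ge0; exact: (shift1_0 hphi).
  have mfU : measurable_fun setT (f \_ U).
    exact/(measurable_restrictT _ mU)/measurable_funTS.
  have fU0 x : 0 <= (f \_ U) x.
    rewrite patchE; case: ifPn => //; rewrite inE => Ux.
    by rewrite lee_fin mulr_ge0// (le_trans _ Ux)// ltW.
  have mng : measurable_fun setT (fun x => `|g x|%:E).
    by apply/measurable_EFinP; exact: measurableT_comp.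
  (* One term per region: [b] for [0 <= g < M], [t * |g|] for [g < 0], and [t * f] for [M <= g]. *)
  apply: (@le_lt_trans _ _ (\int[nu]_x (b%:E + t%:E * `|g x|%:E + t%:E * (f \_ U) x))).
    apply: ge0_le_integral => //.
    - apply: measurableT_comp; first exact: measurable_conjugate.
      exact: measurable_funM.
    - by apply: emeasurable_funD; [apply: emeasurable_funD => //|]; exact: measurable_funeM.
    move=> x _; rewrite patchE; case: ifPn; rewrite ?inE ?notin_setE => Ux.
      have gx0 : (0 <= t * g x)%R by rewrite mulr_ge0 ?(ltW t0)// (le_trans _ Ux)// ltW.
      apply: (le_trans (conjugate_le_max_tilt gx0)).
      rewrite -!EFinM -!EFinD lee_fin mulrCA lerDr addr_ge0//.
      by rewrite mulr_ge0// ltW.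
    rewrite mule0 adde0; have [gx0|gx0] := leP 0%R (g x).
      apply: (@le_trans _ _ b%:E); last by rewrite leeDl// -EFinM lee_fin mulr_ge0// ltW.
      apply: le_trans psistM.
      apply: (star_convex_homo psis_ge0).
      - by apply: conjugate0; [exact: (shift1_ge0 hphi)|exact: (shift1_0 hphi)].
      - by apply: econvex_conjugate; exact: (shift1_ge0 hphi).
      - by rewrite mulr_ge0// ltW.
      by rewrite ler_pM2l// ltW// ltNge; apply/negP.
    apply: (le_trans (conjugate_shift1_le hphi _)).
      by rewrite mulr_ge0_le0// ltW.
    by rewrite ltr0_norm// -EFinM -EFinD lee_fin mulrN lerDr.
  rewrite ge0_integralD//; last 4 first.
  - by move=> x _; rewrite adde_ge0// -EFinM lee_fin mulr_ge0// ltW.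
  - by apply: emeasurable_funD => //; exact: measurable_funeM.
  - by move=> x _; rewrite mule_ge0// lee_fin ltW.
  - exact: measurable_funeM.
  rewrite ge0_integralD//; last 2 first.
  - by move=> x _; rewrite -EFinM lee_fin mulr_ge0// ltW.
  - exact: measurable_funeM.
  rewrite integral_probability_cst ge0_integralZl_EFin ?(ltW t0)//.
  rewrite ge0_integralZl_EFin ?(ltW t0)// -integral_mkcond.
  have /integrableP[_ gfin] := ig.
  rewrite lte_add_pinfty// ?lte_add_pinfty ?ltry// lte_mul_pinfty// ?lee_fin ?(ltW t0)//.
  by rewrite (le_lt_trans le4)// ltry.
(* A single bound serves both for [w], through monotonicity of [max_tilt], and for [g] on the
   support. *)
exists (X \_ (A k)), (Num.max (max_tilt (t * k%:R)) k%:R); split.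
- exact/(measurable_restrictT _ (mA k))/measurable_funTS.
- move=> x; rewrite patchE; case: ifPn; last first.
    by rewrite lexx le_max ler0n orbT.
  rewrite inE => /andP[_ gk]; rewrite X0/= le_max max_tilt_homo//.
  by rewrite ler_pM2l.
- move=> x; rewrite patchE; case: ifPn; rewrite ?eqxx// inE => /andP[-> gk] _ /=.
  by rewrite le_max gk orbT.
- rewrite (_ : \int[nu]_x _ = \int[nu]_(x in A k) f x)// [RHS]integral_mkcond.
  apply: eq_integral => x _; rewrite !patchE; case: ifPn => // _.
  by rewrite mul0r.
- move=> x th th01; rewrite patchE; case: ifPn => _.
    exact: shift1_max_tilt.
  by rewrite mulr0 mul0r (shift1_0 hphi).
Qed.

End optimal_tilt.

(** * Stability forces a finite cumulant on the right *)

Section stability_necessary.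
Context d (T : measurableType d) (R : realType).
Variables (phi : R -> \bar R) (hphi : divergence_generator phi).
Variables (Sigma : set (set T)) (mSigma : Sigma `<=` measurable).
Variables (g : T -> R) (mg : measurable_fun setT g).
Variables (nu : probability T R) (hnu : Xspace1 Sigma g nu).
Local Notation psis := (conjugate (shift1 phi)).
Local Notation c := (slope_pinfty phi).
Local Notation Xi := (null_of_Xspace Sigma g).
Local Notation K := (cumulant phi g nu Xi).
Local Notation D P := (phi_divergence phi (charge_of_finite_measure P) nu).

Hypothesis stable : forall nu_ : nat -> probability T R,
  (forall n, Xspace1 Sigma g (nu_ n)) -> D (nu_ n) @[n --> \oo] --> 0 ->
  \int[nu_ n]_x (g x)%:E @[n --> \oo] --> \int[nu]_x (g x)%:E.

Let ig : nu.-integrable setT (EFin \o g).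
Proof. by have /(Xspace1P mg nu mSigma)[] := hnu. Qed.

Let ig_fin : \int[nu]_x (g x)%:E \is a fin_num.
Proof. exact: integrable_fin_num. Qed.

(** Such [Q] would have divergences tending to 0 and means constantly 1 above that of [nu]. Shifting
    by exactly 1 makes the sequence of means constant, so its limit is immediate. *)
Lemma no_unit_shift (C : R) : ~ forall n : nat, exists Q : probability T R,
  [/\ Xspace1 Sigma g Q, D Q <= (C / n.+1%:R)%:E &
      \int[Q]_x (g x)%:E = \int[nu]_x (g x)%:E + 1].
Proof.
move=> /choice[Q HQ].
have D0 : D (Q n) @[n --> \oo] --> 0.
  apply/nneg_cvge0P => [n|e e0]; first exact: phi_divergence_ge0.
  have : \forall n \near \oo, (C / e <= n%:R)%R by exact: nbhs_infty_ger.
  apply: filterS => n Cn; have [_ h _] := HQ n; apply: (le_trans h).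
  rewrite lee_fin ler_pdivrMr// mulrC -ler_pdivrMr//.
  by rewrite (le_trans Cn)// ler_nat.
have XQ n : Xspace1 Sigma g (Q n) by have [] := HQ n.
have := stable XQ D0.
have -> : (fun n => \int[Q n]_x (g x)%:E) = fun=> \int[nu]_x (g x)%:E + 1.
  by apply/funext => n; have [] := HQ n.
move=> /cvg_lim h1; have := h1 (@ereal_hausdorff R).
have -> : lim ((fun=> \int[nu]_x (g x)%:E + 1) @ \oo) = \int[nu]_x (g x)%:E + 1.
  by apply: cvg_lim => //; exact: cvg_cst.
rewrite -(fineK ig_fin) -EFinD => -[/eqP].
by rewrite -subr_eq0 addrAC subrr add0r oner_eq0.
Qed.

(** By definition of the ideal, some signed measure of X_g charges the set; [P] is its variation,
    restricted to the set and normalized. *)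
Lemma Xspace1_above (n : nat) : ~ Xi [set x | (n%:R < g x)%R] ->
  exists2 P : probability T R, Xspace1 Sigma g P & n%:R%:E <= \int[P]_x (g x)%:E.
Proof.
set A := [set x | _] => XA.
have mA : measurable A.
  have -> : A = g @^-1` `]n%:R, +oo[.
    by apply/seteqP; split=> x /=; rewrite in_itv/= andbT.
  by rewrite -[_ @^-1` _]setTI; exact: mg.
have [mu [[muS mug] muA]] : exists mu : {charge set T -> \bar R},
    Xspace Sigma g mu /\ Defs.variation mu A <> 0.
  apply: contrapT => /forallNP h; apply: XA; split => // mu Xmu.
  by apply: contrapT => muA; apply: (h mu).
pose V : {measure set T -> \bar R} := Defs.variation mu.
have VAfin : V A \is a fin_num by exact: (@fin_num_measure _ _ _ (Defs.variation mu)).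
pose k := fine (V A).
have k0 : (0 < k)%R by rewrite fine_gt0// lt0e measure_ge0 ltey_eq VAfin !andbT; exact/eqP.
have k0' : (0 <= k^-1)%R by rewrite invr_ge0 ltW.
have mAC : measurable (~` A) by exact: measurableC.
pose m : {measure set T -> \bar R} := mscale (NngNum k0') (mrestr V mA).
have mE S : m S = k^-1%:E * V (S `&` A) by [].
have m1 : m setT = 1.
  by rewrite mE setTI -(fineK VAfin) -EFinM mulVf// gt_eqF.
have [Q QE] := probability_of_measure nu m1.
have mng : measurable_fun setT (fun x => `|g x|%:E).
  by apply/measurable_EFinP; exact: measurableT_comp.
have Qg : Q.-integrable setT (EFin \o g).
  apply/integrableP; split; first exact/measurable_EFinP.
  rewrite (eq_measure_integral m); last by move=> S _ _; exact: QE.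
  rewrite -[X in X < _]/(\int[m]_x `|g x|%:E) ge0_integral_mscale//.
  rewrite lte_mul_pinfty//; apply: le_lt_trans mug.
  rewrite [leRHS](eq_measure_integral (measure_add (mrestr V mA) (mrestr V mAC))); last first.
    move=> S mS _; rewrite [RHS]measure_addE /mrestr/= addeC.
    by rewrite (measureDI V mS mA) setDE.
  rewrite ge0_integral_measure_add//.
  by rewrite leeDl// integral_ge0.
exists Q.
  apply/(Xspace1P mg Q mSigma); split => // S SS; rewrite QE mE.
  have mS : measurable S by exact: mSigma.
  have -> : V (S `&` A) = 0; last by rewrite mule0.
  apply/eqP; rewrite eq_le measure_ge0 andbT.
  have /= <- := muS _ SS; apply: (@le_measure _ _ _ V); rewrite ?inE//.
  exact: measurableI.
have QAC : Q (~` A) = 0 by rewrite QE mE setICl measure0 mule0.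
have QA : Q A = 1 by rewrite QE mE setIid -(fineK VAfin) -EFinM mulVf// gt_eqF.
rewrite (negligible_integral mAC measurableT Qg QAC).
rewrite setTD setCK.
apply: (@le_trans _ _ (\int[Q]_(x in A) (cst n%:R%:E x))).
  by rewrite integral_cst// [X in _ * X](_ : _ = 1) ?mule1//.
apply: le_integral => //.
- exact: finite_measure_integrable_cst.
- exact: (integrableS measurableT).
- by move=> x; rewrite inE /A /= => /ltW; rewrite lee_fin.
Qed.

(** [e] solves [(1 - e) * m + e * G = m + 1], with [m] and [G] the means under [nu] and [P]; the
    hypothesis [G >= m + 1] is what puts it in []0, 1]]. *)
Lemma unit_shift_mixture (P : probability T R) : Xspace1 Sigma g P ->
  \int[nu]_x (g x)%:E + 1 <= \int[P]_x (g x)%:E ->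
  let e := (fine (\int[P]_x (g x)%:E) - fine (\int[nu]_x (g x)%:E))^-1%R in
  (0 < e <= 1)%R /\ exists Q, [/\ is_mixture e nu P Q, Xspace1 Sigma g Q &
    \int[Q]_x (g x)%:E = \int[nu]_x (g x)%:E + 1].
Proof.
move=> /(Xspace1P mg P mSigma)[PS Pg].
have Pfin : \int[P]_x (g x)%:E \is a fin_num by exact: integrable_fin_num.
rewrite -(fineK Pfin) -(fineK ig_fin) -EFinD lee_fin /=.
set G := fine (\int[P]_x _); set m := fine _ => mG.
have Gm1 : (1 <= G - m)%R by lra.
have Gm0 : (0 < G - m)%R by lra.
have e01 : (0 < (G - m)^-1 <= 1)%R by rewrite invr_gt0 Gm0 invf_le1.
split => //; have /andP[e0 e1] := e01.
have [|Q [Qmix QI]] := @mixture_exists _ T R (G - m)^-1%R nu P; first by rewrite ltW.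
have [|Qg Qint] := mixture_integral _ QI ig Pg; first by rewrite ltW.
have /(Xspace1P mg nu mSigma)[nuS _] := hnu.
exists Q; split => //.
  apply/(Xspace1P mg Q mSigma); split => // S SS.
  by rewrite Qmix ?nuS ?PS ?mule0 ?adde0//; exact: mSigma.
rewrite Qint -(fineK Pfin) -(fineK ig_fin) -/G -/m -!EFinM -!EFinD; congr EFin.
by field; rewrite gt_eqF.
Qed.

Lemma ideal_bounded_above : c < +oo -> exists n : nat, Xi [set x | (n%:R < g x)%R].
Proof.
move=> coo; apply: contrapT => /forallNP XN.
have [C [b [C0 b0 hC]]] := generator_near1 hphi.
have := slope_pinfty_ge0 hphi; case E : c coo => [r| |]// _ r0.
apply: (@no_unit_shift (C + r)) => n.
set m := fine (\int[nu]_x (g x)%:E).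
(* A mean above this [N] makes [e] at most both [b], where the linear bound on [phi (1 - e)]
   applies, and [1 / (n + 1)]. *)
pose N := (Num.truncn (`|m| + n.+1%:R + b^-1)%R).+1.
have hN : (`|m| + n.+1%:R + b^-1 < N%:R)%R by exact: truncnS_gt.
have [P XP PN] := Xspace1_above (XN N).
have /(Xspace1P mg P mSigma)[_ Pg] := XP.
have Pfin : \int[P]_x (g x)%:E \is a fin_num by exact: integrable_fin_num.
have mm := ler_norm m; have n1 : (1 <= n.+1%:R :> R)%R by rewrite ler1n.
have b1 : (0 < b^-1)%R by rewrite invr_gt0.
have [|/= e01 [Q [Qmix XQ Qg]]] := unit_shift_mixture XP.
  apply: le_trans PN; rewrite -(fineK ig_fin) -EFinD lee_fin -/m; lra.
exists Q; split => //.
apply: (le_trans (mixture_divergence_le_slope hphi e01 Qmix)).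
move: PN; rewrite -(fineK Pfin) lee_fin -/m.
move: e01; rewrite -/m; set G := fine _ => e01 PN.
have /andP[e0 _] := e01.
have eb : ((G - m)^-1 <= b)%R by rewrite -[b]invrK lef_pV2 ?posrE//; lra.
have en : ((G - m)^-1 <= n.+1%:R^-1)%R by rewrite lef_pV2 ?posrE//; lra.
apply: (le_trans (leeD (hC _ _) (lexx _))); first by rewrite (ltW e0).
rewrite E -EFinM -EFinD lee_fin mulrC -mulrDr mulrC.
by rewrite ler_wpM2l// addr_ge0.
Qed.

(** The multiplier [- n] makes the argument of psi^* nonpositive outside a null set; there psi^* is
    at most the absolute value of its argument, which is integrable. *)
Lemma cumulant_finite_bounded (n : nat) : Xi [set x | (n%:R < g x)%R] ->
  K 1%R < +oo.
Proof.
move=> Xn; have hXi := sigma_ideal_null_of_Xspace Sigma g.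
have nun : nu [set x | (n%:R < g x)%R] = 0 by exact: (null_of_Xspace_null hnu).
apply: (@le_lt_trans _ _ (\int[nu]_x psis (1 * g x + - n%:R)%R)).
  apply: (cumulant_le hphi hXi nu mg).
  apply: (sigma_idealS hXi Xn).
    rewrite -[X in measurable X]setTI; apply: emeasurable_fun_o_infty => //.
    apply/measurable_EFinP; apply: measurable_funD => //; exact: measurable_funM.
  move=> x /=; apply: contraTT; rewrite -!leNgt mul1r => gn.
  by apply: le_trans (slope_pinfty_ge0 hphi); rewrite lee_fin subr_le0.
have mgn : measurable_fun setT (fun x => 1 * g x + - n%:R)%R.
  by apply: measurable_funD => //; exact: measurable_funM.
apply: (@le_lt_trans _ _ (\int[nu]_x `|1 * g x + - n%:R|%:E)).
  apply: ae_ge0_le_integral => //.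
  - by move=> x _; apply: conjugate_ge0; exact: (shift1_0 hphi).
  - by apply: measurableT_comp mgn; exact: measurable_conjugate.
  - by apply/measurable_EFinP; exact: measurableT_comp.
  exists [set x | (n%:R < g x)%R]; split => //; first by have [] := Xn.
  move=> x /= /not_implyP[_ /negP h]; rewrite ltNge; apply: contra h => gn.
  have y0 : (1 * g x + - n%:R <= 0)%R by rewrite mul1r subr_le0.
  by rewrite (le_trans (conjugate_shift1_le hphi y0))// ler0_norm.
have : nu.-integrable setT (fun x => (1 * g x + - n%:R)%:E).
  under eq_fun do rewrite EFinD EFinM.
  by apply: integrableD => //; [exact: integrableZl|exact: finite_measure_integrable_cst].
by move=> /integrableP[].
Qed.

(** If all integrals were infinite, tilting with [t = 1 / (n + 1)] would give probabilities [P] of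
    arbitrarily large mean [G]. Mixing with weight [e = 1 / (G - m)] costs at most
    [C * e + t * e * G], and [e * G] stays below 2. *)
Lemma conjugate_integrable : c = +oo ->
  exists2 t : R, (0 < t)%R & \int[nu]_x psis (t * g x)%R < +oo.
Proof.
move=> coo; apply: contrapT => small.
have ioo (t : R) : (0 < t)%R -> \int[nu]_x psis (t * g x)%R = +oo.
  move=> t0; apply/eqP; rewrite -leye_eq leNgt; apply/negP => ti.
  by apply: small; exists t.
have [C [b [C0 b0 hC]]] := generator_near1 hphi.
apply: (@no_unit_shift (C + 2)) => n.
set m := fine (\int[nu]_x (g x)%:E).
(* The term [2 * |m|] yields [e * G <= 2] and [e / S < 1]; the last two terms yield
   [e <= 1 / (n + 1)] and [e <= b]. *)
pose M := (2 * `|m| + 1 + n.+1%:R + b^-1)%R.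
have mm := ler_norm m; have m0 := normr_ge0 m.
have n1 : (1 <= n.+1%:R :> R)%R by rewrite ler1n.
have b1 : (0 < b^-1)%R by rewrite invr_gt0.
have M0 : (0 < M)%R by rewrite /M; lra.
pose t : R := n.+1%:R^-1%R; have t0 : (0 < t)%R by rewrite invr_gt0.
have [w [k [mw wk wg I4 psiw]]] := tilting_density hphi coo ig t0 M0 (ioo t t0).
have w0 x : (0 <= w x)%R by have /andP[] := wk x.
have wgM x : (M * w x <= w x * g x)%R.
  have [->|/wg/andP[Mg _]] := eqVneq (w x) 0%R; first by rewrite mulr0 mul0r.
  by rewrite mulrC ler_wpM2l.
have wgk x : (w x * g x <= k * w x)%R.
  have [->|/wg/andP[_ gk]] := eqVneq (w x) 0%R; first by rewrite mulr0 mul0r.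
  by rewrite mulrC ler_wpM2r.
have wg0 x : (0 <= w x * g x)%R by rewrite (le_trans _ (wgM x))// mulr_ge0// ltW.
have mwE : measurable_fun setT (fun x => (w x)%:E) by exact/measurable_EFinP.
have mwgE : measurable_fun setT (fun x => (w x * g x)%:E).
  by apply/measurable_EFinP; exact: measurable_funM.
have wfin : \int[nu]_x (w x)%:E \is a fin_num.
  rewrite ge0_fin_numE ?integral_ge0//; last by move=> x _; rewrite lee_fin.
  apply: (@le_lt_trans _ _ (\int[nu]_x k%:E)); last by rewrite integral_probability_cst ltry.
  apply: ge0_le_integral => //; first by move=> x _; rewrite lee_fin.
  by move=> x _; rewrite lee_fin; have /andP[] := wk x.
have IkS : \int[nu]_x (w x * g x)%:E <= k%:E * \int[nu]_x (w x)%:E.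
  rewrite -ge0_integralZl_EFin//; last 2 first.
  - by move=> x _; rewrite lee_fin.
  - by have /andP[a1 a2] := wk point; exact: le_trans a2.
  apply: ge0_le_integral => //; first by move=> x _; rewrite lee_fin.
  - exact: measurable_funeM.
  - by move=> x _; rewrite -EFinM lee_fin.
have IMS : M%:E * \int[nu]_x (w x)%:E <= \int[nu]_x (w x * g x)%:E.
  rewrite -ge0_integralZl_EFin ?(ltW M0)//; last by move=> x _; rewrite lee_fin.
  apply: ge0_le_integral => //.
  - by move=> x _; rewrite -EFinM lee_fin mulr_ge0// ltW.
  - exact: measurable_funeM.
  - by move=> x _; rewrite -EFinM lee_fin.
have Ifin : \int[nu]_x (w x * g x)%:E \is a fin_num.
  rewrite ge0_fin_numE ?integral_ge0//; last by move=> x _; rewrite lee_fin.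
  by apply: (le_lt_trans IkS); rewrite -(fineK wfin) -EFinM ltry.
move: IkS IMS I4; rewrite -(fineK wfin) -(fineK Ifin) -!EFinM !lee_fin.
set S := fine (\int[nu]_x (w x)%:E); set I := fine _ => IkS IMS I4.
have S_ge0 : (0 <= S)%R by apply/fine_ge0/integral_ge0 => x _; rewrite lee_fin.
have S0 : (0 < S)%R.
  rewrite lt_def S_ge0 andbT; apply/eqP => S0; move: IkS I4; rewrite S0 mulr0; lra.
pose p x := (w x / S)%R.
have p0 x : (0 <= p x)%R by rewrite divr_ge0.
have mp : measurable_fun setT p by apply: measurable_funM.
have mpE : measurable_fun setT (fun x => (p x)%:E) by exact/measurable_EFinP.
have p1 : \int[nu]_x (p x)%:E = 1.
  transitivity (\int[nu]_x (S^-1%:E * (w x)%:E)).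
    by apply: eq_integral => x _; rewrite -EFinM mulrC.
  rewrite ge0_integralZl_EFin//; last 2 first.
  - by move=> x _; rewrite lee_fin.
  - by rewrite invr_ge0.
  by rewrite -(fineK wfin) -EFinM mulVf// gt_eqF.
have [P PE] := probability_of_density mp p0 p1.
have Pint (u : T -> \bar R) : measurable_fun setT u -> (forall x, 0 <= u x) ->
    \int[P]_x u x = \int[nu]_x (u x * (p x)%:E).
  exact: (density_change_of_variables mpE p0 PE).
have gpos x : (Num.max (g x) 0 * p x = S^-1 * (w x * g x))%R.
  rewrite /p; have [->|/wg/andP[Mg _]] := eqVneq (w x) 0%R; first by rewrite !mul0r !mulr0.
  have /max_idPl -> : (0 <= g x)%R by apply: le_trans Mg; exact: ltW.
  by ring.
have gneg x : (Num.max (- g x) 0 * p x = 0)%R.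
  rewrite /p; have [->|/wg/andP[Mg _]] := eqVneq (w x) 0%R; first by rewrite mul0r mulr0.
  have /max_idPr -> : (- g x <= 0)%R; last by rewrite mul0r.
  by rewrite oppr_le0; apply: le_trans Mg; exact: ltW.
have mgpos : measurable_fun setT (fun x => (Num.max (g x) 0)%:E).
  by apply/measurable_EFinP; exact: measurable_maxr.
have mgneg : measurable_fun setT (fun x => (Num.max (- g x) 0)%:E).
  by apply/measurable_EFinP; apply: measurable_maxr => //; exact: measurableT_comp.
have Ppos : \int[P]_x (Num.max (g x) 0)%:E = (I / S)%:E.
  rewrite Pint//; last by move=> x; rewrite lee_fin le_max lexx orbT.
  under eq_integral do rewrite -EFinM gpos EFinM.
  rewrite ge0_integralZl_EFin//; last 2 first.
  - by move=> x _; rewrite lee_fin.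
  - by rewrite invr_ge0.
  by rewrite -(fineK Ifin) -EFinM mulrC.
have Pneg : \int[P]_x (Num.max (- g x) 0)%:E = 0.
  rewrite Pint//; last by move=> x; rewrite lee_fin le_max lexx orbT.
  under eq_integral do rewrite -EFinM gneg.
  by rewrite integral0.
have Pg : P.-integrable setT (EFin \o g).
  by apply: integrable_posneg => //; rewrite ?Ppos ?Pneg ltry.
have PG : \int[P]_x (g x)%:E = (I / S)%:E.
  rewrite integralE -Ppos -[RHS]sube0 -Pneg; congr (_ - _).
    by apply: eq_integral => x _; rewrite funeposE /= EFin_max.
  by apply: eq_integral => x _; rewrite funenegE /= EFin_max.
have XP : Xspace1 Sigma g P.
  apply/(Xspace1P mg P mSigma); split => // A SA.
  have /(Xspace1P mg nu mSigma)[nuS _] := hnu.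
  have mA := mSigma SA.
  rewrite PE//; apply: null_set_integral => //; last exact: nuS.
  exact: measurable_funTS.
have MG : (M <= I / S)%R by rewrite ler_pdivlMr.
have [|/= e01 [Q [Qmix XQ Qg]]] := unit_shift_mixture XP.
  by rewrite PG -(fineK ig_fin) -EFinD lee_fin -/m (le_trans _ MG)// /M; lra.
exists Q; split => //.
have PE' A : measurable A -> P A = \int[nu]_(x in A) (p x)%:E by exact: PE.
apply: (le_trans (mixture_divergence_le_density hphi coo e01 Qmix mp p0 PE')).
move: e01; rewrite PG /= -/m; set e := (_ - _)^-1%R => /andP[e0 e1].
have Gm0 : (0 < I / S - m)%R by rewrite -invr_gt0.
have eb : (e <= b)%R by rewrite /e -[b]invrK lef_pV2 ?posrE//; move: MG; rewrite /M; lra.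
have en : (e <= n.+1%:R^-1)%R by rewrite /e lef_pV2 ?posrE//; move: MG; rewrite /M; lra.
have eG : (e * (I / S) <= 2)%R.
  by rewrite /e mulrC ler_pdivrMr//; move: MG; rewrite /M; lra.
(* The cost bound on [w] holds for factors below 1 only, and [e * p] is [e / S * w]. The claim
   amounts to [I - m * S > 1]: from [M >= 2 * |m|] and [M * S <= I], the left side is at least
   [I / 2], and [I >= 4]. *)
have eS : (e / S < 1)%R.
  rewrite /e -invfM invf_lt1 ?mulr_gt0// mulrBl divfK ?gt_eqF//.
  have : (2 * `|m| * S <= M * S)%R by rewrite ler_wpM2r// /M; lra.
  have : (m * S <= `|m| * S)%R by rewrite ler_wpM2r.
  by lra.
have eS0 : (0 <= e / S)%R by rewrite divr_ge0 ?(ltW e0).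
have psibound : \int[nu]_x shift1 phi (e * p x)%R <= (t * (e * (I / S)))%:E.
  apply: (@le_trans _ _ (\int[nu]_x ((t * e / S)%:E * (w x * g x)%:E))).
    apply: ge0_le_integral => //.
    - by move=> x _; exact: shift1_ge0.
    - apply: (measurableT_comp (measurable_generator hphi)).
      by apply: measurable_funD => //; exact: measurable_funM.
    - exact: measurable_funeM.
    move=> x _; have -> : (e * p x = e / S * w x)%R by rewrite /p; ring.
    apply: (le_trans (psiw x _ _)); first by rewrite eS0.
    by rewrite -EFinM lee_fin le_eqVlt; apply/orP; left; apply/eqP; ring.
  rewrite ge0_integralZl_EFin//; last 2 first.
  - by move=> x _; rewrite lee_fin.
  - by rewrite divr_ge0// mulr_ge0// ltW.
  by rewrite -(fineK Ifin) -EFinM lee_fin -/I le_eqVlt; apply/orP; left; apply/eqP; ring.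
apply: (le_trans (leeD (hC _ _) psibound)); first by rewrite (ltW e0).
rewrite -EFinD lee_fin mulrDl; apply: lerD; first by rewrite ler_wpM2l.
by rewrite mulrC /t ler_wpM2r// invr_ge0.
Qed.

End stability_necessary.

(** * Equivalences *)

Section integrable_opposite.
Context d (T : measurableType d) (R : realType).
Variables (P : probability T R) (g : T -> R).
Hypothesis ig : P.-integrable setT (EFin \o g).

Lemma integrable_oppr : P.-integrable setT (EFin \o (fun x => - g x)%R).
Proof. exact: integrableN ig. Qed.

Lemma integral_oppr : \int[P]_x (- g x)%:E = - \int[P]_x (g x)%:E.
Proof.
transitivity (\int[P]_x ((-1)%:E * (g x)%:E)).
  by apply: eq_integral => x _; rewrite -EFinM mulN1r.
by rewrite integralZl// mulN1e.
Qed.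

End integrable_opposite.

Section stability_equivalence.
Context d (T : measurableType d) (R : realType).
Variables (phi : R -> \bar R) (hphi : divergence_generator phi).
Variables (Sigma : set (set T)) (mSigma : Sigma `<=` measurable).
Variable (nu : probability T R).
Local Notation c := (slope_pinfty phi).
Local Notation Xi g := (null_of_Xspace Sigma g).
Local Notation K g := (cumulant phi g nu (Xi g)).
Local Notation D P := (phi_divergence phi (charge_of_finite_measure P) nu).
Local Notation opp g := (fun x => - g x)%R.

Definition stable (g : T -> R) := forall nu_ : nat -> probability T R,
  (forall n, Xspace1 Sigma g (nu_ n)) -> D (nu_ n) @[n --> \oo] --> 0 ->
  \int[nu_ n]_x (g x)%:E @[n --> \oo] --> \int[nu]_x (g x)%:E.

Definition right_finite (g : T -> R) := exists2 t : R, (0 < t)%R & K g t < +oo.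

Definition right_small (g : T -> R) := forall e : R, (0 < e)%R ->
  exists2 t : R, (0 < t)%R & K g t <= (e * t)%:E.

Lemma Xspace1N g : Xspace1 Sigma (opp g) = Xspace1 Sigma g :> set (probability T R).
Proof. by rewrite /Xspace1 XspaceN. Qed.

Lemma cumulant_opp g t : K (opp g) t = K g (- t)%R.
Proof. by rewrite null_of_XspaceN cumulantN. Qed.

Lemma stableN g : measurable_fun setT g -> Xspace1 Sigma g nu ->
  stable g -> stable (opp g).
Proof.
move=> mg hnu st nu_; rewrite Xspace1N => Xnu D0.
have ig P : Xspace1 Sigma g P -> P.-integrable setT (EFin \o g).
  by move=> /(Xspace1P mg P mSigma)[].
rewrite integral_oppr; last exact: ig.
under eq_fun => n do rewrite (integral_oppr (ig _ (Xnu n))).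
by apply: cvgeN; exact: st.
Qed.

Lemma stable_right_finite g : measurable_fun setT g -> Xspace1 Sigma g nu ->
  stable g -> right_finite g.
Proof.
move=> mg hnu st; have hXi := sigma_ideal_null_of_Xspace Sigma g.
have [coo|coo] := eqVneq c +oo; last first.
  have clt : c < +oo by rewrite ltey.
  have [n Xn] := ideal_bounded_above hphi mSigma mg hnu st clt.
  by exists 1%R => //; exact: (cumulant_finite_bounded hphi mSigma mg hnu Xn).
have [t t0 it] := conjugate_integrable hphi mSigma mg hnu st coo.
exists t => //; apply: le_lt_trans it.
(* An infinite slope leaves [l] unconstrained, so the multiplier 0 is admissible. *)
have := @cumulant_le _ _ _ _ hphi _ hXi nu _ mg t 0%R.
under eq_integral do rewrite addr0.
apply; rewrite coo (_ : mkset _ = set0); first exact: sigma_ideal0.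
by apply/seteqP; split.
Qed.

Lemma right_finite_small g : ~ ([set x | phi x = 0])° 1%R ->
  measurable_fun setT g -> Xspace1 Sigma g nu -> right_finite g -> right_small g.
Proof.
move=> hphi1 mg hnu [t t0 Kt]; have /(Xspace1P mg nu mSigma)[_ ig] := hnu.
exact: (cumulant_small hphi (sigma_ideal_null_of_Xspace Sigma g) mg ig hphi1 t0 Kt).
Qed.

(** Finiteness provides an admissible [l], and with a finite slope [r] the constraint
    [t * g + l <= r] bounds [g] by [(r - l) / t] off the ideal. *)
Lemma right_finite_bounded g : measurable_fun setT g ->
  c < +oo -> right_finite g ->
  exists n : nat, Xi g [set x | (n%:R < g x)%R].
Proof.
move=> mg coo [t t0 /(cumulant_lt hphi (sigma_ideal_null_of_Xspace Sigma g) mg)[l Xl _]].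
have := slope_pinfty_ge0 hphi; case E : c coo => [r| |]// _ r0.
exists (Num.truncn ((r - l) / t)%R).+1.
set n := _.+1; have rn : ((r - l) / t < n%:R)%R by exact: truncnS_gt.
apply: (sigma_idealS (sigma_ideal_null_of_Xspace Sigma g) Xl).
  have -> : [set x | (n%:R < g x)%R] = g @^-1` `]n%:R, +oo[.
    by apply/seteqP; split=> x /=; rewrite in_itv/= andbT.
  by rewrite -[_ @^-1` _]setTI; exact: mg.
move=> x /= ng; rewrite E lte_fin -ltrBlDr mulrC -ltr_pdivrMr//.
exact: lt_trans rn ng.
Qed.

Section fixed_function.
Variables (g : T -> R) (mg : measurable_fun setT g) (hnu : Xspace1 Sigma g nu).

Let mgN : measurable_fun setT (opp g).
Proof. exact: measurableT_comp. Qed.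

Let hnuN : Xspace1 Sigma (opp g) nu.
Proof. by rewrite Xspace1N. Qed.

Let ig : nu.-integrable setT (EFin \o g).
Proof. by have /(Xspace1P mg nu mSigma)[] := hnu. Qed.

Let hXi := sigma_ideal_null_of_Xspace Sigma g.

Lemma cumulant_near0 t s : (0 < t)%R -> (0 < s)%R ->
  forall y : R, (`|y| < t)%R -> (`|y| < s)%R ->
  K g y <= (`|y| / t)%:E * K g t \/ K g y <= (`|y| / s)%:E * K g (- s)%R.
Proof.
move=> t0 s0 y yt ys; have [y0|/ltW y0] := leP 0%R y; [left|right].
  rewrite -{1}(divfK (lt0r_neq0 t0) y) ger0_norm//.
  apply: (cumulant_scale hphi hXi nu mg).
  by rewrite divr_ge0 ?(ltW t0)//= ler_pdivrMr// mul1r ltW// -(ger0_norm y0).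
have {1}-> : y = (`|y| / s * - s)%R by rewrite mulrN divfK ?gt_eqF// ler0_norm// opprK.
apply: (cumulant_scale hphi hXi nu mg).
by rewrite divr_ge0 ?(ltW s0)//= ler_pdivrMr// mul1r ltW.
Qed.

Lemma finite_interior : right_finite g -> right_finite (opp g) ->
  (edom (K g))° 0%R.
Proof.
move=> [t t0 Kt] [s s0]; rewrite cumulant_opp => Ks.
exists (Num.min t s) => /=; first by rewrite lt_min t0.
move=> y /=; rewrite sub0r normrN lt_min => /andP[yt ys].
rewrite /edom/=; have [|] := cumulant_near0 t0 s0 yt ys => /le_lt_trans; apply.
- by rewrite lte_mul_pinfty// lee_fin divr_ge0// ltW.
- by rewrite lte_mul_pinfty// lee_fin divr_ge0// ltW.
Qed.

Lemma interior_finite : (edom (K g))° 0%R ->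
  right_finite g /\ right_finite (opp g).
Proof.
move=> [r /= r0 rK]; have r2 : (0 < r / 2)%R by rewrite divr_gt0.
have r2r : (r / 2 < r)%R by lra.
split; exists (r / 2)%R => //; rewrite ?cumulant_opp; apply: rK => /=.
  by rewrite sub0r normrN gtr0_norm.
by rewrite sub0r opprK gtr0_norm.
Qed.

Lemma finite_bounded_subexponential : right_finite g -> right_finite (opp g) ->
  (c < +oo -> in_Linfty (Xi g) g) /\ (c = +oo -> subexponential phi g nu).
Proof.
move=> fg fgN; split=> coo.
  apply/(in_LinftyP Sigma mg); split; first exact: (right_finite_bounded mg coo fg).
  by have := right_finite_bounded mgN coo fgN; rewrite null_of_XspaceN.
(* With an infinite slope the constraint is void, so the cumulant does not depend on the ideal. *)
rewrite /subexponential (_ : cumulant _ _ _ _ = K g); first exact: finite_interior.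
apply/funext => t; rewrite /cumulant; congr (ereal_inf (_ @` _)).
by apply/seteqP; split=> l _ /=; rewrite coo leey.
Qed.

Lemma bounded_subexponential_finite :
  (c < +oo -> in_Linfty (Xi g) g) /\ (c = +oo -> subexponential phi g nu) ->
  right_finite g /\ right_finite (opp g).
Proof.
move=> [bnd sub]; have [coo|coo] := eqVneq c +oo; last first.
  have clt : c < +oo by rewrite ltey.
  have /(in_LinftyP Sigma mg)[[n Xn] [m Xm]] := bnd clt.
  split; exists 1%R => //.
    exact: (cumulant_finite_bounded hphi mSigma mg hnu Xn).
  apply: (@cumulant_finite_bounded _ _ _ _ hphi _ mSigma _ mgN _ hnuN m).
  by rewrite null_of_XspaceN.
apply: interior_finite; have := sub coo.
rewrite /subexponential (_ : cumulant _ _ _ _ = K g)//.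
apply/funext => t; rewrite /cumulant; congr (ereal_inf (_ @` _)).
by apply/seteqP; split=> l _ /=; rewrite coo leey.
Qed.

Lemma small_continuity : right_small g -> right_small (opp g) ->
  forall nu_ : nat -> probability T R, (forall n, Mc1 (Xi g) (nu_ n)) ->
  D (nu_ n) @[n --> \oo] --> 0 ->
  (\forall n \near \oo, (nu_ n).-integrable [set: T] (EFin \o g)) /\
  \int[nu_ n]_x (g x)%:E @[n --> \oo] --> \int[nu]_x (g x)%:E.
Proof.
move=> sg sgN nu_ Mnu /nneg_cvge0P D0.
have {}D0 := D0 (fun n => phi_divergence_ge0 hphi nu (nu_ n)).
have uc e := divergence_upper_continuity hphi hXi mg ig sg (e := e).
have hXiN := sigma_ideal_null_of_Xspace Sigma (opp g).
have ucN e := divergence_upper_continuity hphi hXiN mgN (integrable_oppr ig) sgN (e := e).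
have MnuN n A : Xi (opp g) A -> nu_ n A = 0 by rewrite null_of_XspaceN; exact: Mnu.
have int : \forall n \near \oo, (nu_ n).-integrable [set: T] (EFin \o g).
  have [b b0 h] := uc 1%R ltr01; have [b' b'0 h'] := ucN 1%R ltr01.
  apply: filterS2 (D0 b b0) (D0 b' b'0) => n Db Db'.
  have [pos _] := h _ (Mnu n) Db.
  have [neg _] := h' _ (MnuN n) Db'.
  exact: integrable_posneg.
split => //; have ifin : \int[nu]_x (g x)%:E \is a fin_num by exact: integrable_fin_num.
rewrite -(fineK ifin); apply/fine_cvgP; split.
  by apply: filterS int => n gn; exact: integrable_fin_num.
apply/cvgrPdist_le => e e0.
have [b b0 h] := uc e e0; have [b' b'0 h'] := ucN e e0.
apply: filterS3 int (D0 b b0) (D0 b' b'0) => n gn Db Db'.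
have [_ /(_ gn)] := h _ (Mnu n) Db.
have [_ /(_ (integrable_oppr gn))] := h' _ (MnuN n) Db'.
have nfin : \int[nu_ n]_x (g x)%:E \is a fin_num by exact: integrable_fin_num.
rewrite !integral_oppr// -(fineK ifin) -(fineK nfin) -!EFinN -!EFinD !lee_fin /=.
by rewrite ler_norml => h1 h2; apply/andP; split; lra.
Qed.

Lemma small_subdifferential : right_small g -> right_small (opp g) ->
  subdifferential (K g) 0%R = [set 0%R].
Proof.
move=> sg sgN; apply/seteqP; split=> [s [_ hs]|_ ->]; last first.
  split; first by rewrite (cumulant0 hphi hXi).
  by move=> y; rewrite (cumulant0 hphi hXi)// mul0r adde0 (cumulant_ge0 hphi).
apply/eqP; rewrite eq_le; apply/andP; split; apply/ler_addgt0Pr => e e0.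
  have [t t0 Kt] := sg e e0.
  have := le_trans (hs t) Kt; rewrite (cumulant0 hphi hXi)// add0e subr0 lee_fin.
  by rewrite ler_pM2r// add0r.
have [t t0] := sgN e e0; rewrite cumulant_opp => Kt.
have := le_trans (hs (- t)%R) Kt; rewrite (cumulant0 hphi hXi)// add0e subr0 lee_fin.
by rewrite mulrN -mulNr ler_pM2r// => h; lra.
Qed.

(** If smallness on the right failed at [e], then [K t > e * t] for all [t > 0]; as the cumulant is
    nonnegative, [e] would be a subgradient. The other side gives [- e]. *)
Lemma subdifferential_small : subdifferential (K g) 0%R = [set 0%R] ->
  right_small g /\ right_small (opp g).
Proof.
move=> sub; have K0 := cumulant0 hphi hXi nu mg; have Kge0 := cumulant_ge0 hphi (Xi g) nu g.
split=> e e0; apply: contrapT => small.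
  suff : subdifferential (K g) 0%R e by rewrite sub /= => /eqP; rewrite gt_eqF.
  split; first by rewrite K0.
  move=> y; rewrite K0 add0e subr0; have [y0|y0] := leP y 0%R.
    by apply: le_trans (Kge0 y); rewrite lee_fin mulr_ge0_le0// ltW.
  rewrite leNgt; apply/negP => /ltW Ky; apply: small; by exists y.
suff : subdifferential (K g) 0%R (- e)%R.
  by rewrite sub /= => /eqP; rewrite oppr_eq0 gt_eqF.
split; first by rewrite K0.
move=> y; rewrite K0 add0e subr0; have [y0|y0] := leP 0%R y.
  by apply: le_trans (Kge0 y); rewrite lee_fin mulNr oppr_le0 mulr_ge0// ltW.
rewrite leNgt; apply/negP => /ltW Ky; apply: small; exists (- y)%R; rewrite ?oppr_gt0//.
by rewrite cumulant_opp opprK mulrN -mulNr.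
Qed.

(** Scaling from [t] and from [- s] spreads the two bounds to [K y <= e * |y|] near 0; since the
    cumulant is nonnegative, its difference quotients at 0 tend to 0. *)
Lemma small_differentiable : right_small g -> right_small (opp g) ->
  differentiable_with (K g) 0%R 0%R.
Proof.
move=> sg sgN; have K0 := cumulant0 hphi hXi nu mg.
have Kge0 := cumulant_ge0 hphi (Xi g) nu g.
have bound e : (0 < e)%R -> \forall y \near (0 : R)%R, K g y <= (e * `|y|)%:E.
  move=> e0; have [t t0 Kt] := sg e e0.
  have [s s0] := sgN e e0; rewrite cumulant_opp => Ks.
  exists (Num.min t s) => /=; first by rewrite lt_min t0.
  move=> y /=; rewrite sub0r normrN lt_min => /andP[yt ys].
  have [|] := cumulant_near0 t0 s0 yt ys => /le_trans; apply.
    apply: (@le_trans _ _ ((`|y| / t)%:E * (e * t)%:E)).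
      by apply: lee_wpmul2l => //; rewrite lee_fin divr_ge0// ltW.
    rewrite -EFinM lee_fin le_eqVlt; apply/orP; left; apply/eqP.
    by field; rewrite gt_eqF.
  apply: (@le_trans _ _ ((`|y| / s)%:E * (e * s)%:E)).
    by apply: lee_wpmul2l => //; rewrite lee_fin divr_ge0// ltW.
  rewrite -EFinM lee_fin le_eqVlt; apply/orP; left; apply/eqP.
  by field; rewrite gt_eqF.
split.
  apply: filterS (bound 1%R ltr01) => y Ky.
  by rewrite ge0_fin_numE// (le_lt_trans Ky)// ltry.
have cvg0 : (h^-1 *: (((fine \o K g) \o shift 0) (h *: 1) - (fine \o K g) 0))%R
    @[h --> (0%R : R)^'] --> (0%R : R).
  apply/cvgr0Pnorm_le => e e0.
  have := nbhs_dnbhs (bound e e0).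
  have := @nbhs_dnbhs_neq R 0%R.
  apply: filterS2 => y y0 Ky.
  rewrite /= K0 /= subr0 addr0 normrM normfV.
  rewrite ler_pdivrMl ?normr_gt0// [y *: 1]mulr1.
  rewrite ger0_norm ?fine_ge0// mulrC -lee_fin fineK//.
  by rewrite ge0_fin_numE// (le_lt_trans Ky)// ltry.
apply: DeriveDef; first by apply/cvg_ex; exists 0%R.
exact: cvg_lim cvg0.
Qed.

Lemma differentiable_interior : differentiable_with (K g) 0%R 0%R ->
  (edom (K g))° 0%R.
Proof.
by move=> [h _]; apply: filterS h => y Ky; rewrite /edom/= ltey_eq Ky.
Qed.

End fixed_function.

End stability_equivalence.

Theorem theorem5p4p4 (d : measure_display) (T : measurableType d) (R : realType)
    (nontrivial : exists A : set T, [/\ measurable A, A <> set0 & A <> [set: T]])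
    (phi : R -> \bar R) (hphi : divergence_generator phi)
    (hphi1 : ~ ([set x | phi x = 0])° (1 : R)%R)
    (Sigma : set (set T)) (hSigma : sigma_ideal Sigma)
    (g : T -> R) (hg : measurable_fun [set: T] g)
    (nu : probability T R) (hnu : Xspace1 Sigma g nu) :
  let Xi := null_of_Xspace Sigma g in
  let D (mu : probability T R) :=
    phi_divergence phi (charge_of_finite_measure mu) nu in
  let K := cumulant phi g nu Xi in
  [<->
    (* (i) *)
    forall nu_ : nat -> probability T R, (forall n, Mc1 Xi (nu_ n)) ->
      D (nu_ n) @[n --> \oo] --> 0 ->
      (\forall n \near \oo, (nu_ n).-integrable [set: T] (EFin \o g)) /\
      \int[nu_ n]_x (g x)%:E @[n --> \oo] --> \int[nu]_x (g x)%:E;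
    (* (ii) *)
    forall nu_ : nat -> probability T R, (forall n, Xspace1 Sigma g (nu_ n)) ->
      D (nu_ n) @[n --> \oo] --> 0 ->
      \int[nu_ n]_x (g x)%:E @[n --> \oo] --> \int[nu]_x (g x)%:E;
    (* (iii) and its reformulation *)
    subdifferential K 0%R = [set 0%R];
    differentiable_with K 0 0;
    (* (iv) and its reformulation *)
    (edom K)° 0%R;
    (slope_pinfty phi < +oo -> in_Linfty Xi g) /\
    (slope_pinfty phi = +oo -> subexponential phi g nu) ].
Proof.
have mSigma := sigma_ideal_measurable hSigma.
have hgN : measurable_fun setT (fun x => - g x)%R by exact: measurableT_comp.
have hnuN : Xspace1 Sigma (fun x => - g x)%R nu by rewrite Xspace1N.
move=> Xi D K.
pose finite := right_finite phi Sigma nu g /\ right_finite phi Sigma nu (fun x => - g x)%R.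
pose small := right_small phi Sigma nu g /\ right_small phi Sigma nu (fun x => - g x)%R.
(* The hypothesis that 1 is not interior to the zero set of [phi] enters here; the implication
   serves both from (ii) to (iii) and to close the cycle from (iv) to (i). *)
have finite_small : finite -> small.
  by move=> [fg fgN]; split; exact: right_finite_small.
tfae.
- move=> h nu_ Xnu D0; have [|_] // := h nu_ _ D0 => n A XA.
  exact: null_of_Xspace_null (Xnu n) XA.
- move=> st; have [sg sgN] : small.
    apply: finite_small; split; first exact: stable_right_finite.
    by apply: stable_right_finite => //; exact: stableN.
  exact: small_subdifferential.
- move=> /(subdifferential_small hphi hg)[]; exact: small_differentiable.
- exact: differentiable_interior.
- move=> /interior_finite[]; exact: finite_bounded_subexponential.
- move=> /(bounded_subexponential_finite hphi mSigma hg hnu)/finite_small[].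
  exact: small_continuity.
Qed.
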